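(* Let $X$ be a countably infinite set, $\mathscr{A}=2^X$, and $\mu$ a measure on $\mathscr{A}$ with $\mu(x):=\mu(\{x\})<\infty$ for every $x\in X$. Let $\phi$ be a transformation of $X$ such that (a) for every $x\in X$, $\mu(x)=0$ if and only if $\mu(\phi^{-1}(\{x\}))=0$; (b) $\mu(\phi^{-1}(\{x\}))<\infty$ for every $x\in X$ with $\mu(x)>0$. For $x\in X$ let $\phi^{-1}\langle x\rangle=\{y\in\phi^{-1}(\{x\}):\mu(y)>0\}$. Suppose there exists a family $P\colon X\times\mathfrak{B}(\mathbb{R}_+)\to[0,1]$ of probability measures (i.e. each $P(x,\cdot)$ is a Borel probability measure on $\mathbb{R}_+$) satisfying one of the following (mutually equivalent) conditions: (i) for every $x\in X$ with $\mu(\phi^{-1}(\{x\}))>0$: $\int_\sigma t\,P(x,\mathrm{d}t)=\sum_{y\in\phi^{-1}\langle x\rangle}\frac{\mu(y)}{\mu(x)}P(y,\sigma)$ for all $\sigma\in\mathfrak{B}(\mathbb{R}_+)$; (ii) for every $x\in X$ with $\mu(\phi^{-1}(\{x\}))>0$: $P(y,\{0\})=0$ for every $y\in\phi^{-1}\langle x\rangle$, and $P(x,\sigma)=\sum_{y\in\phi^{-1}\langle x\rangle}\frac{\mu(y)}{\mu(x)}\int_\sigma\frac1t P(y,\mathrm{d}t)$ for all $\sigma\in\mathfrak{B}(\mathbb{R}_+)$; (iii) for every $x\in X$ with $\mu(\phi^{-1}(\{x\}))>0$: $P(y,\cdot)\ll P(x,\cdot)$ for every $y\in\phi^{-1}\langle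 x\rangle$, and $t=\sum_{y\in\phi^{-1}\langle x\rangle}\frac{\mu(y)}{\mu(x)}\frac{\mathrm{d}P(y,\cdot)}{\mathrm{d}P(x,\cdot)}(t)$ for $P(x,\cdot)$-a.e. $t\in\mathbb{R}_+$; (iv) for every $x\in X$ with $\mu(\phi^{-1}(\{x\}))>0$: $P(x,\{0\})=0$, $P(y,\cdot)\ll P(x,\cdot)$ for every $y\in\phi^{-1}\langle x\rangle$, and $1=\sum_{y\in\phi^{-1}\langle x\rangle}\frac{\mu(y)}{\mu(x)}\frac1t\frac{\mathrm{d}P(y,\cdot)}{\mathrm{d}P(x,\cdot)}(t)$ for $P(x,\cdot)$-a.e. $t\in\mathbb{R}_+$. Then the composition operator $C_\phi$ in $L^2(\mu)$ is subnormal.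
   Context: $\mathbb{R}_+=[0,\infty)$, $\mathfrak{B}(\mathbb{R}_+)$ its Borel sets; convention $1/0=\infty$, $0\cdot\infty=0$. The composition operator is $\mathcal{D}(C_\phi)=\{f\in L^2(\mu):f\circ\phi\in L^2(\mu)\}$, $C_\phi f=f\circ\phi$ (well defined since $\phi$ is nonsingular by (a)). A densely defined operator $S$ in $\mathcal{H}$ is subnormal if there are a Hilbert space $\mathcal{K}\supseteq\mathcal{H}$ (isometric embedding) and a normal operator $N$ in $\mathcal{K}$ with $\mathcal{D}(S)\subseteq\mathcal{D}(N)$ and $Sf=Nf$ on $\mathcal{D}(S)$. *)

(* Defs.v *)
(* mathcomp-analysis (measure theory, Radon-Nikodym) +
   mathcomp-real-closed complex numbers R[i]. *)
From mathcomp Require Import all_boot all_order all_algebra.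
From mathcomp Require Import all_classical all_reals all_analysis.
From mathcomp Require Import complex.
Import Order.TTheory GRing.Theory Num.Theory.

Set Implicit Arguments.
Unset Strict Implicit.
Unset Printing Implicit Defensive.

Local Open Scope ring_scope.
Local Open Scope classical_set_scope.

(* The measure mu on 2^X, X countable: mu(A) = sum_{x in A} mu({x}).   *)
(* It is given by the (finite, nonnegative) point masses w x = mu(x).  *)
Definition wmeasure (X : choiceType) (R : realType) (w : X -> R) (A : set X) : \bar R :=
  (\esum_(x in A) (w x)%:E)%E.

(* phi^{-1}<x> = { y in phi^{-1}({x}) : mu(y) > 0 } *)
Definition ppos (X : choiceType) (R : realType) (phi : X -> X) (w : X -> R) (x : X) : set X :=
  [set y | phi y = x /\ 0 < w y].

(* 1/t with the convention 1/0 = +oo *)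
Definition einv (R : realType) (t : R) : \bar R :=
  if t == 0 then +oo%E else (t^-1)%:E.

(* The nonnegative half-line R_+ = [0, +oo) as a set *)
Definition Rplus (R : realType) : set R := [set t | 0 <= t].

Local Open Scope ereal_scope.

Definition cond_i (X : choiceType) (R : realType) (w : X -> R) (phi : X -> X)
    (P : X -> probability R R) : Prop :=
  forall x, 0 < wmeasure w (phi @^-1` [set x]) ->
  forall sigma : set R, measurable sigma -> sigma `<=` (@Rplus R) ->
    \int[P x]_(t in sigma) t%:E
    = \esum_(y in ppos phi w x) ((w y / w x)%:E * P y sigma).

Definition cond_ii (X : choiceType) (R : realType) (w : X -> R) (phi : X -> X)
    (P : X -> probability R R) : Prop :=
  forall x, 0 < wmeasure w (phi @^-1` [set x]) ->
  (forall y, ppos phi w x y -> P y [set 0%R] = 0) /\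
  (forall sigma : set R, measurable sigma -> sigma `<=` (@Rplus R) ->
    P x sigma
    = \esum_(y in ppos phi w x) ((w y / w x)%:E * \int[P y]_(t in sigma) einv t)).

Definition cond_iii (X : choiceType) (R : realType) (w : X -> R) (phi : X -> X)
    (P : X -> probability R R) : Prop :=
  forall x, 0 < wmeasure w (phi @^-1` [set x]) ->
  (forall y, ppos phi w x y -> P y `<< P x) /\
  {ae P x, forall t : R, (@Rplus R) t ->
     t%:E = \esum_(y in ppos phi w x)
              ((w y / w x)%:E *
               Radon_Nikodym (charge_of_finite_measure (P y)) (P x) t)}.

Definition cond_iv (X : choiceType) (R : realType) (w : X -> R) (phi : X -> X)
    (P : X -> probability R R) : Prop :=
  forall x, 0 < wmeasure w (phi @^-1` [set x]) ->
  P x [set 0%R] = 0 /\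
  (forall y, ppos phi w x y -> P y `<< P x) /\
  {ae P x, forall t : R, (@Rplus R) t ->
     1 = \esum_(y in ppos phi w x)
              ((w y / w x)%:E * einv t *
               Radon_Nikodym (charge_of_finite_measure (P y)) (P x) t)}.

Local Close Scope ereal_scope.

(* Complex Hilbert spaces and (unbounded) normal operators             *)

(* squared norm  <x, x>  (a nonnegative real) *)
Definition knorm2 (R : realType) (K : lmodType R[i]) (ip : K -> K -> R[i]) (x : K) : R :=
  complex.Re (ip x x).

(* norm convergence u n --> l in K *)
Definition kconv (R : realType) (K : lmodType R[i]) (ip : K -> K -> R[i])
    (u : nat -> K) (l : K) : Prop :=
  forall e : R, 0 < e -> exists M, forall n, (M <= n)%N -> knorm2 ip (u n - l) < e.

(* ip is an inner product (linear in the first variable) making K complete *)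
Definition is_hilbert (R : realType) (K : lmodType R[i]) (ip : K -> K -> R[i]) : Prop :=
  [/\ (forall (a : R[i]) (x y z : K), ip (a *: x + y) z = a * ip x z + ip y z),
      (forall x y, ip x y = (ip y x)^*),
      (forall x, 0 <= knorm2 ip x),
      (forall x, knorm2 ip x = 0 -> x = 0) &
      (forall u : nat -> K,
         (forall e : R, 0 < e -> exists M, forall m n, (M <= m)%N -> (M <= n)%N ->
             knorm2 ip (u m - u n) < e) ->
         exists l, kconv ip u l)].

(* g is in the domain of the adjoint N^* of the operator (D, N), and N^* g = h *)
Definition adjrel (R : realType) (K : lmodType R[i]) (ip : K -> K -> R[i])
    (D : set K) (N : K -> K) (g h : K) : Prop :=
  forall f, D f -> ip (N f) g = ip f h.

(* (D, N) is a normal operator in K: a closed densely defined linear operator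
   with N^* N = N N^* (equality of operators, i.e. of graphs). *)
Definition is_normal (R : realType) (K : lmodType R[i]) (ip : K -> K -> R[i])
    (D : set K) (N : K -> K) : Prop :=
  [/\ D 0 /\ (forall (a : R[i]) f g, D f -> D g -> D (a *: f + g)),
      (forall (a : R[i]) f g, D f -> D g -> N (a *: f + g) = a *: N f + N g),
      (forall f (e : R), 0 < e -> exists g, D g /\ knorm2 ip (f - g) < e),
      (forall (u : nat -> K) f g, (forall n, D (u n)) ->
          kconv ip u f -> kconv ip (fun n => N (u n)) g -> D f /\ N f = g) &
      (forall f k, (D f /\ adjrel ip D N (N f) k) <->
                   (exists h, adjrel ip D N f h /\ D h /\ N h = k))].

(* L^2(mu) and the composition operator                                *)

(* |z|^2 *)
Definition csq (R : realType) (z : R[i]) : R :=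
  (complex.Re z) ^+ 2 + (complex.Im z) ^+ 2.

(* || f ||^2 = int |f|^2 dmu = sum_x mu(x) |f x|^2 *)
Definition l2norm2 (X : choiceType) (R : realType) (w : X -> R) (f : X -> R[i]) : \bar R :=
  (\esum_(x in [set: X]) (w x * csq (f x))%:E)%E.

Definition inL2 (X : choiceType) (R : realType) (w : X -> R) (f : X -> R[i]) : Prop :=
  (l2norm2 w f < +oo)%E.

(* D(C_phi) = { f in L^2(mu) : f o phi in L^2(mu) } *)
Definition dom_Cphi (X : choiceType) (R : realType) (w : X -> R) (phi : X -> X)
    (f : X -> R[i]) : Prop :=
  inL2 w f /\ inL2 w (f \o phi).

(* C_phi is subnormal: it is densely defined in L^2(mu), and there are a complex
   Hilbert space K, an isometric linear embedding J : L^2(mu) -> K and a normal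
   operator N in K with J(D(C_phi)) included in D(N) and N (J f) = J (C_phi f). *)
Definition Cphi_subnormal (X : choiceType) (R : realType) (w : X -> R) (phi : X -> X) : Prop :=
  (forall f, inL2 w f -> forall e : R, 0 < e ->
     exists g, dom_Cphi w phi g /\ (l2norm2 w (fun x => (f x - g x)%R) < e%:E)%E) /\
  exists (K : lmodType R[i]) (ip : K -> K -> R[i]) (J : (X -> R[i]) -> K)
         (D : set K) (N : K -> K),
    [/\ is_hilbert ip,
        (forall (a : R[i]) f g, inL2 w f -> inL2 w g ->
            J (fun x => a * f x + g x) = a *: J f + J g),
        (forall f, inL2 w f -> ((knorm2 ip (J f))%:E = l2norm2 w f)%E),
        is_normal ip D N &
        (forall f, dom_Cphi w phi f -> D (J f) /\ N (J f) = J (f \o phi))].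

(* Main.v *)
(* The idea: dilate phi to an invertible transformation.  Conditions (ii), (iii)
   and (iv) each imply (i) through Radon-Nikodym derivatives.  Let p_x be the
   density of mu(x) P(x, .) with respect to a finite measure la dominating all
   P(x, .).  Condition (i) then says t p_x(t) = sum over phi(y) = x of p_y(t).
   Over each t, assign to every x an interval of length p_x(t), and cut the
   interval of x into pieces of lengths p_y(t) / t for phi(y) = x.  Stretching the
   pieces onto the intervals of the y's is the inverse of a bijection Phi of the
   plane that carries the cell of y into the cell of phi(y), leaves t fixed, and
   satisfies int (F o Phi) = int (h F) with h = t on the cells and 1 elsewhere
   (la times Lebesgue measure).
   As h o Phi = h, composition with Phi is a normal operator, with adjoint
   g |-> h (g o Phi^-1).  It extends C_phi when f in L^2(mu) is identified with
   the function equal to f(x) on the cell of x and to 0 off the cells. *)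
Require Import Defs.
From HB Require Import structures.
From mathcomp Require Import all_boot all_order all_algebra.
From mathcomp Require Import all_classical all_reals all_analysis.
From mathcomp Require Import measurable_realfun complex.
From mathcomp Require Import ring lra.
Import Order.TTheory GRing.Theory Num.Theory.
Import numFieldNormedType.Exports.
Set Implicit Arguments.
Unset Strict Implicit.
Unset Printing Implicit Defensive.
Local Open Scope ring_scope.
Local Open Scope classical_set_scope.

(** * Real square-integrable functions *)

(** On the disjoint union of the half-lines {x} x R_+, with the measure mu(x) P(x, dt), the map (x,
    t) |-> (phi x, t) already extends phi and, by (i), has Jacobian t. It merges points wherever phi
    does, so composition with it is in general only quasinormal. The extra coordinate of the plane
    separates these points; the map becomes invertible, and the adjoint is a weighted composition
    with the inverse. Two obstacles shape the details. The identity between densities holds only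
    almost everywhere, whereas the cutting of intervals must be exact on every line; hence all
    densities are set to 0 on one common null set and for t <= 0. And the operator may be unbounded,
    so its adjoint has to be found with its exact domain; this is done on the slices h <= n, which
    Phi preserves because h o Phi = h. *)

Section L2.
Context d (T : measurableType d) (R : realType) (m : {measure set T -> \bar R}).
Implicit Types f g k : T -> R.

Definition sqint f : \bar R := (\int[m]_x (f x ^+ 2)%:E)%E.
Definition l2 f : Prop := measurable_fun setT f /\ (sqint f < +oo)%E.
Definition l2ip f g : R := Rintegral m setT (fun x => f x * g x).

Lemma sqint_ge0 f : (0 <= sqint f)%E.
Proof. by apply: integral_ge0 => x _; rewrite lee_fin sqr_ge0. Qed.

Lemma measurable_sq f : measurable_fun setT f ->
  measurable_fun setT (fun x => (f x ^+ 2)%:E).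
Proof. by move=> mf; apply/measurable_EFinP; exact: measurable_funX. Qed.

Lemma sqint_le f g : measurable_fun setT f -> measurable_fun setT g ->
  (forall x, f x ^+ 2 <= g x ^+ 2) -> (sqint f <= sqint g)%E.
Proof.
move=> mf mg fg; apply: ge0_le_integral => //.
- by move=> x _; rewrite lee_fin sqr_ge0.
- exact: measurable_sq.
- exact: measurable_sq.
- by move=> x _; rewrite lee_fin.
Qed.

Lemma sqintZ a f : measurable_fun setT f ->
  sqint (fun x => a * f x) = ((a ^+ 2)%:E * sqint f)%E.
Proof.
move=> mf; rewrite /sqint -ge0_integralZl //.
- by apply: eq_integral => x _; rewrite -EFinM exprMn.
- exact: measurable_sq.
- by move=> x _; rewrite lee_fin sqr_ge0.
- by rewrite lee_fin sqr_ge0.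
Qed.

Lemma sqintBC f g : sqint (fun x => f x - g x) = sqint (fun x => g x - f x).
Proof. by apply: eq_integral => x _; rewrite -sqrrN opprB. Qed.

Lemma sqintD_le f g : measurable_fun setT f -> measurable_fun setT g ->
  (sqint (fun x => f x + g x)%R <= 2%:E * sqint f + 2%:E * sqint g)%E.
Proof.
move=> mf mg.
rewrite /sqint -!ge0_integralZl//; last 4 first.
- exact: measurable_sq.
- by move=> x _; rewrite lee_fin sqr_ge0.
- exact: measurable_sq.
- by move=> x _; rewrite lee_fin sqr_ge0.
rewrite -ge0_integralD//; last 4 first.
- by move=> x _; rewrite -EFinM lee_fin mulr_ge0 ?sqr_ge0.
- by apply: emeasurable_funM => //; exact: measurable_sq.
- by move=> x _; rewrite -EFinM lee_fin mulr_ge0 ?sqr_ge0.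
- by apply: emeasurable_funM => //; exact: measurable_sq.
apply: ge0_le_integral => //.
- by move=> x _; rewrite lee_fin sqr_ge0.
- by apply: measurable_sq; exact: measurable_funD.
- by apply: emeasurable_funD; apply: emeasurable_funM => //; exact: measurable_sq.
- move=> x _; rewrite -!EFinM -EFinD lee_fin.
  have := sqr_ge0 (f x - g x); nra.
Qed.

Lemma l2_lin a f g : l2 f -> l2 g -> l2 (fun x => a * f x + g x).
Proof.
move=> [mf qf] [mg qg]; split.
  by apply: measurable_funD => //; exact: measurable_funM.
apply: (le_lt_trans (sqintD_le _ _)) => //; first exact: measurable_funM.
rewrite sqintZ // -[X in (X < _)%E]/(_ + _)%E.
by apply: lte_add_pinfty; rewrite ?lte_mul_pinfty ?mule_ge0 ?lee_fin ?sqr_ge0 ?sqint_ge0.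
Qed.

Lemma l2_0 : l2 (fun=> 0).
Proof.
split; first exact: measurable_cst.
by rewrite /sqint (eq_integral (cst 0%E)) ?integral0// => x _; rewrite expr0n.
Qed.

Lemma l2Z a f : l2 f -> l2 (fun x => a * f x).
Proof.
by move=> /(l2_lin a)/(_ l2_0); congr l2; apply/funext => x; rewrite addr0.
Qed.

Lemma l2B f g : l2 f -> l2 g -> l2 (fun x => f x - g x).
Proof.
move=> lf /(l2_lin (-1)) /(_ lf); congr l2; apply/funext => x.
by rewrite mulN1r addrC.
Qed.

Lemma l2_int f g : l2 f -> l2 g -> m.-integrable setT (fun x => (f x * g x)%:E).
Proof.
move=> [mf qf] [mg qg]; apply/integrableP; split.
  by apply/measurable_EFinP; exact: measurable_funM.
apply: (@le_lt_trans _ _ (sqint f + sqint g)%E); last exact: lte_add_pinfty.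
rewrite /sqint -ge0_integralD //; last 4 first.
- by move=> x _; rewrite lee_fin sqr_ge0.
- exact: measurable_sq.
- by move=> x _; rewrite lee_fin sqr_ge0.
- exact: measurable_sq.
apply: ge0_le_integral => //.
- by apply: measurableT_comp => //; apply/measurable_EFinP; exact: measurable_funM.
- by apply: emeasurable_funD; exact: measurable_sq.
- move=> x _; rewrite /= lee_fin normrM.
  rewrite -[f x ^+ 2]real_normK ?num_real// -[g x ^+ 2]real_normK ?num_real//.
  have := sqr_ge0 (`|f x| - `|g x|).
  have : 0 <= `|f x| ^+ 2 by exact: sqr_ge0.
  have : 0 <= `|g x| ^+ 2 by exact: sqr_ge0.
  nra.
Qed.

Lemma l2ipC f g : l2ip f g = l2ip g f.
Proof. by apply: eq_Rintegral => x _; rewrite mulrC. Qed.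

Lemma l2ip0l f : l2ip (fun=> 0) f = 0.
Proof. by rewrite /l2ip; under eq_Rintegral do rewrite mul0r; rewrite /Rintegral integral0. Qed.

Lemma l2ip_linl a f g k : l2 f -> l2 g -> l2 k ->
  l2ip (fun x => a * f x + g x) k = a * l2ip f k + l2ip g k.
Proof.
move=> lf lg lk; rewrite /l2ip -RintegralZl//; last exact: l2_int.
rewrite -RintegralD//; last 2 first.
- rewrite (_ : _ \o _ = (EFin \o (fun x => (a * f x) * k x))).
    by apply: l2_int => //; exact: l2Z.
  by apply/funext => x /=; rewrite mulrA.
- exact: l2_int.
by apply: eq_Rintegral => x _; rewrite mulrDl mulrA.
Qed.

Lemma l2ipBl f g k : l2 f -> l2 g -> l2 k ->
  l2ip (fun x => f x - g x) k = l2ip f k - l2ip g k.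
Proof.
move=> lf lg lk.
rewrite (_ : (fun x => _) = (fun x => -1 * g x + f x)).
  by rewrite l2ip_linl// mulN1r addrC.
by apply/funext => x; rewrite mulN1r addrC.
Qed.

Lemma l2ip_linr a f g k : l2 f -> l2 g -> l2 k ->
  l2ip k (fun x => a * f x + g x) = a * l2ip k f + l2ip k g.
Proof. by move=> *; rewrite l2ipC l2ip_linl// ![l2ip k _]l2ipC. Qed.

Lemma l2ipBr f g k : l2 f -> l2 g -> l2 k ->
  l2ip k (fun x => f x - g x) = l2ip k f - l2ip k g.
Proof. by move=> *; rewrite l2ipC l2ipBl// ![l2ip k _]l2ipC. Qed.

Lemma l2ip_self f : l2 f -> (l2ip f f)%:E = sqint f.
Proof.
move=> [mf qf]; rewrite /l2ip /Rintegral fineK.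
  by apply: eq_integral => x _; rewrite expr2.
rewrite (_ : integral _ _ _ = sqint f); last first.
  by apply: eq_integral => x _; rewrite expr2.
by rewrite ge0_fin_numE ?sqint_ge0.
Qed.

Lemma l2ip_self_ge0 f : 0 <= l2ip f f.
Proof. by apply: Rintegral_ge0 => x _; rewrite -expr2 sqr_ge0. Qed.

Lemma l2ip_CS f g : l2 f -> l2 g -> l2ip f g ^+ 2 <= l2ip f f * l2ip g g.
Proof.
move=> lf lg.
have H s : 0 <= l2ip f f * s ^+ 2 + 2 * s * l2ip f g + l2ip g g.
  have := l2ip_self_ge0 (fun x => s * f x + g x).
  have lfg := l2_lin s lf lg.
  rewrite l2ip_linl// !l2ip_linr// (l2ipC g f).
  by congr (_ <= _); ring.
have [f0|f0] := eqVneq (l2ip f f) 0.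
  rewrite f0 mul0r; have [->|fg0] := eqVneq (l2ip f g) 0; first by rewrite expr0n.
  (* Here the quadratic is affine in [s]; this [s] gives it the value -1. *)
  have := H (- (l2ip g g + 1) / (2 * l2ip f g)).
  rewrite f0 mul0r add0r.
  rewrite (_ : 2 * _ * _ = - (l2ip g g + 1)); last by field.
  lra.
have fpos : 0 < l2ip f f by rewrite lt_neqAle eq_sym f0 l2ip_self_ge0.
(* The minimiser of the quadratic. *)
have := H (- l2ip f g / l2ip f f).
rewrite (_ : _ + _ + _ = l2ip g g - l2ip f g ^+ 2 / l2ip f f); last by field.
by rewrite subr_ge0 ler_pdivrMr// mulrC.
Qed.

Lemma sqint0_ae f : measurable_fun setT f -> sqint f = 0%E -> {ae m, forall x, f x = 0}.
Proof.
move=> mf q0.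
have /ae_eq_integral_abs : (\int[m]_x `| (f x ^+ 2)%:E | = 0)%E.
  by rewrite -[RHS]q0; apply: eq_integral => x _; rewrite gee0_abs// lee_fin sqr_ge0.
move=> /(_ measurableT (measurable_sq mf)).
apply: filterS => x /(_ I) [] /eqP.
by rewrite sqrf_eq0 => /eqP.
Qed.

Lemma ae0_sqint f : measurable_fun setT f -> {ae m, forall x, f x = 0} -> sqint f = 0%E.
Proof.
move=> mf f0; rewrite -[RHS](integral0 m setT); apply: ae_eq_integral => //.
- exact: measurable_sq.
- by apply: filterS f0 => x -> _; rewrite expr0n.
Qed.

Definition aeq f g := {ae m, forall x, f x = g x}.

Lemma aeq_sqint f g : measurable_fun setT f -> measurable_fun setT g ->
  aeq f g -> sqint f = sqint g.
Proof.
move=> mf mg fg; apply: ae_eq_integral => //; try exact: measurable_sq.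
by apply: filterS fg => x -> _.
Qed.

Lemma aeq_l2 f g : l2 f -> measurable_fun setT g -> aeq f g -> l2 g.
Proof.
by move=> [mf qf] mg fg; split => //; rewrite -(aeq_sqint mf mg fg).
Qed.

Lemma aeq_sym f g : aeq f g -> aeq g f.
Proof. by apply: filterS => x ->. Qed.

Lemma aeq_trans f g k : aeq f g -> aeq g k -> aeq f k.
Proof. by apply: filterS2 => x -> ->. Qed.

Lemma aeq_ipl f g k : measurable_fun setT f -> measurable_fun setT g -> measurable_fun setT k ->
  aeq f g -> l2ip f k = l2ip g k.
Proof.
move=> mf mg mk fg; congr fine; apply: ae_eq_integral => //.
- by apply/measurable_EFinP; exact: measurable_funM.
- by apply/measurable_EFinP; exact: measurable_funM.
- by apply: filterS fg => x -> _.
Qed.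

Lemma sqintB0_aeq f g : measurable_fun setT f -> measurable_fun setT g ->
  sqint (fun x => f x - g x) = 0%E -> aeq f g.
Proof.
move=> mf mg /sqint0_ae; have mfg : measurable_fun setT (fun x => f x - g x).
  exact: measurable_funB.
by move=> /(_ mfg); apply: filterS => x /eqP; rewrite subr_eq0 => /eqP.
Qed.

(** Testing with [f - g] itself gives norm zero. This is what makes it faithful to represent a class
    of functions by its pairings. *)
Lemma ip_ext_aeq f g : l2 f -> l2 g ->
  (forall k, l2 k -> l2ip f k = l2ip g k) -> aeq f g.
Proof.
move=> lf lg fg; apply: sqintB0_aeq; [exact: lf.1|exact: lg.1|].
rewrite -l2ip_self; last exact: l2B.
by rewrite l2ipBl ?fg ?subrr//; exact: l2B.
Qed.

End L2.

(** * Completeness of L^2 *)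

Section RieszFischer.
Context d (T : measurableType d) (R : realType) (m : {measure set T -> \bar R}).
Local Notation sqint := (sqint m).
Local Notation l2 := (l2 m).

Lemma ge0_sum_bound (a : nat -> R) (C : R) : (forall n, 0 <= a n) ->
  (\sum_(0 <= n <oo) (a n)%:E <= C%:E)%E -> forall n, a n <= C.
Proof.
move=> a0 aC n; rewrite -lee_fin; apply: le_trans aC.
apply: le_trans (nneseries_lim_ge n.+1 _) => /=; last by move=> i _ _; rewrite lee_fin.
by rewrite big_nat_recr//= leeDr// sume_ge0// => i _; rewrite lee_fin.
Qed.

(** The increments are at most (C + 1) 2^-k, so the telescoping series converges absolutely. *)
Lemma half_decay_cvg (v : nat -> R) (C : R) :
  (forall k, 4 ^+ k * (v k.+1 - v k) ^+ 2 <= C) -> cvgn v.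
Proof.
move=> H.
have C0 : 0 <= C by apply: le_trans (H 0%N); apply: mulr_ge0; [exact: exprn_ge0|exact: sqr_ge0].
(* From y^2 <= C and y >= 0 follows y <= C + 1, which avoids a square root. *)
have bnd k : `|v k.+1 - v k| <= geometric (C + 1) (2^-1) k.
  rewrite /geometric/= exprVn ler_pdivlMr ?exprn_gt0//.
  have := H k; set x := v k.+1 - v k.
  rewrite -[x ^+ 2]real_normK ?num_real// (_ : 4 = 2 ^+ 2 :> R); last by rewrite -natrX.
  rewrite -exprM mulnC exprM -exprMn [_ * `|x|]mulrC => sC.
  set y := `|x| * 2 ^+ k in sC *.
  have : 0 <= y by rewrite mulr_ge0// exprn_ge0.
  nra.
have cd : cvgn (series (fun k => v k.+1 - v k)).
  apply: normed_cvg; apply: (series_le_cvg _ _ bnd) => //.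
    by move=> n; rewrite /geometric/= mulr_ge0 ?exprn_ge0 ?addr_ge0.
  by apply: is_cvg_geometric_series; rewrite ger0_norm// invf_lt1// ltr1n.
rewrite (_ : v = (fun k => v 0%N + series (fun k => v k.+1 - v k) k)).
  exact: is_cvgD (is_cvg_cst _) cd.
apply/funext => k; rewrite seriesEnat/=.
by rewrite telescope_sumr// addrC subrK.
Qed.

(** The factor 4^-k in the bound cancels the weight 4^k in [S]; the remaining 2^-(k+1) is summable,
    so [S] has a finite integral. *)
Lemma l2_fast_cauchy (v : nat -> T -> R) : (forall n, l2 (v n)) ->
  (forall k, (sqint (fun x => v k.+1 x - v k x)%R <= (4 ^- k / (2 ^ (k + 1))%:R)%:E)%E) ->
  exists f : T -> R, measurable_fun setT f /\ {ae m, forall x, v k x @[k --> \oo] --> f x}.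
Proof.
move=> lv dv.
(* Almost everywhere finiteness of S forces |v (k+1) - v k| = O(2^-k). *)
pose S x := (\sum_(0 <= k <oo) (4 ^+ k * (v k.+1 x - v k x) ^+ 2)%:E)%E.
have S0 k x : (0 <= (4 ^+ k * (v k.+1 x - v k x) ^+ 2)%:E)%E.
  by rewrite lee_fin; apply: mulr_ge0; [exact: exprn_ge0|exact: sqr_ge0].
have md k : measurable_fun setT (fun x => v k.+1 x - v k x).
  by apply: measurable_funB; apply: (lv _).1.
have mSk k : measurable_fun setT (fun x => (4 ^+ k * (v k.+1 x - v k x) ^+ 2)%:E).
  by apply/measurable_EFinP; apply: measurable_funM => //; exact: measurable_funX.
have mS : measurable_fun setT S by exact: ge0_emeasurable_sum.
have S0x x : (0 <= S x)%E by apply: nneseries_ge0 => k _ _.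
have iS : m.-integrable setT S.
  apply/integrableP; split => //.
  under eq_integral => x _ do rewrite gee0_abs//.
  rewrite /S integral_nneseries//.
  apply: (@le_lt_trans _ _ (\sum_(0 <= k <oo) (1 / (2 ^ (k + 1))%:R)%:E)%E); last first.
    have /cvg_lim -> // := @cvg_geometric_eseries_half R 1 0.
    exact: ltry.
  apply: lee_nneseries => k _; first by move=> _; apply: integral_ge0 => x _.
  rewrite (_ : integral _ _ _ = ((4 ^+ k)%:E * sqint (fun x => v k.+1 x - v k x)%R)%E).
    have p4 : (0 <= (4 ^+ k : R)%:E)%E by rewrite lee_fin exprn_ge0.
    apply: le_trans (lee_wpmul2l p4 (dv k)) _.
    by rewrite -EFinM mulrA divff// gt_eqF// exprn_gt0.
  rewrite /sqint -ge0_integralZl//.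
  - exact: measurable_sq.
  - by move=> x _; rewrite lee_fin sqr_ge0.
have Sfin : {ae m, forall x, (S x < +oo)%E}.
  by have := integrable_ae measurableT iS; apply: filterS => x /(_ I);
    rewrite ge0_fin_numE.
pose b x := (S x < +oo)%E.
have mb : measurable_fun setT b.
  by apply: measurable_fun_lte => //; exact: measurable_cst.
have cv x : b x -> cvgn (v ^~ x).
  rewrite /b -ge0_fin_numE// => Sx.
  apply: (@half_decay_cvg _ (fine (S x))).
  by apply: ge0_sum_bound => [n|]; rewrite -?lee_fin// fineK.
(* The value 0 where [S] is infinite makes the limit function measurable on the whole space. *)
exists (fun x => if b x then limn (v ^~ x) else 0); split.
  apply: (@measurable_fun_cvg _ _ _ _ (fun k x => if b x then v k x else 0)).
    by move=> k; apply: measurable_fun_ifT => //; exact: (lv k).1.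
  move=> x _; case: ifPn => bx; last exact: cvg_cst.
  exact: cv.
by apply: filterS Sfin => x bx; rewrite /b bx; exact: cv.
Qed.

(** Fatou's lemma for the squares (g - v k)^2. With [g] a late term of a Cauchy sequence and [v] a
    subsequence, it turns the Cauchy estimate into convergence to the pointwise limit. *)
Lemma l2_fatou (v : nat -> T -> R) (f g : T -> R) (e : R) : (forall n, l2 (v n)) ->
  measurable_fun setT f -> measurable_fun setT g ->
  {ae m, forall x, v k x @[k --> \oo] --> f x} ->
  (forall k, (sqint (fun x => g x - v k x)%R <= e%:E)%E) ->
  (sqint (fun x => g x - f x)%R <= e%:E)%E.
Proof.
move=> lv mf mg vf ve.
have mgv k : measurable_fun setT (fun x => ((g x - v k x) ^+ 2)%:E).
  by apply: measurable_sq; apply: measurable_funB => //; exact: (lv k).1.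
have mgf : measurable_fun setT (fun x => ((g x - f x) ^+ 2)%:E).
  by apply: measurable_sq; exact: measurable_funB.
rewrite /sqint (@ae_eq_integral _ _ _ m setT
  (fun x => limn_einf (fun k => ((g x - v k x) ^+ 2)%:E)))//; last 2 first.
- rewrite (_ : (fun _ => _) = (fun x => limn (einfs (fun k => ((g x - v k x) ^+ 2)%:E))));
    last by apply/funext => x; rewrite limn_einf_lim.
  apply: (@emeasurable_fun_cvg _ _ _ _
      (fun n x => einfs (fun k => ((g x - v k x) ^+ 2)%:E) n)).
    by move=> n; exact: measurable_fun_einfs.
  by move=> x _; exact: is_cvg_einfs.
- apply: filterS vf => x vx _.
  suff /cvg_limn_einf_sup[-> _] // :
    (fun k => ((g x - v k x) ^+ 2)%:E) @ \oo --> ((g x - f x) ^+ 2)%:E by [].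
  apply/cvg_EFin; first by near=> n.
  by apply: cvgM; (apply: cvgB => //; exact: cvg_cst).
apply: le_trans (fatou m measurableT _ _) _ => //.
  by move=> n x _; rewrite lee_fin sqr_ge0.
rewrite limn_einf_lim.
apply: lime_le; first exact: is_cvg_einfs.
near=> n; apply: (@le_trans _ _ (sqint (fun x => g x - v n x)%R)); last exact: ve.
apply: ereal_inf_lbound => /=; exists n => //=.
Unshelve. all: by end_near. Qed.

Lemma l2_complete (u : nat -> T -> R) : (forall n, l2 (u n)) ->
  (forall e : R, 0 < e -> exists M, forall i j, (M <= i)%N -> (M <= j)%N ->
     (sqint (fun x => u i x - u j x)%R < e%:E)%E) ->
  exists f : T -> R, l2 f /\ forall e : R, 0 < e -> exists M, forall n, (M <= n)%N ->
     (sqint (fun x => u n x - f x)%R < e%:E)%E.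
Proof.
move=> lu cu.
pose eps k : R := 4 ^- k / (2 ^ (k + 1))%:R.
have eps0 k : 0 < eps k by rewrite divr_gt0// ?invr_gt0 ?exprn_gt0// ltr0n expn_gt0.
have /choice [N HN] : forall k, exists M, forall i j, (M <= i)%N -> (M <= j)%N ->
     (sqint (fun x => u i x - u j x)%R < (eps k)%:E)%E by move=> k; exact: cu.
(* Partial sums of the positive numbers [(N i).+1]: a strictly increasing choice of indices with
   [s k] at least [N k]. *)
pose s k := (\sum_(i < k.+1) (N i).+1)%N.
have Ns k : (N k <= s k)%N.
  by rewrite /s big_ord_recr/=; apply: leq_trans (leqnSn _) (leq_addl _ _).
have ss k : (s k < s k.+1)%N by rewrite /s [X in (_ < X)%N]big_ord_recr/= addnS ltnS leq_addr.
have ks k : (k <= s k)%N by elim: k => // k IH; exact: leq_ltn_trans (ss k).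
pose v k := u (s k).
have [|f [mf vf]] := @l2_fast_cauchy v (fun k => lu (s k)).
  move=> k; apply/ltW; apply: HN; last exact: Ns.
  exact: leq_trans (Ns k) (ltnW (ss k)).
have fin e : 0 < e -> exists M, forall n, (M <= n)%N ->
     (sqint (fun x => u n x - f x)%R < e%:E)%E.
  move=> e0; have [M HM] := cu (e / 2) (divr_gt0 e0 (ltr0Sn _ 1)).
  exists M => n Mn; apply: (@le_lt_trans _ _ (e / 2)%:E); last first.
    by rewrite lte_fin ltr_pdivrMr// ltr_pMr// ltr1n.
  apply: (@l2_fatou (fun k => v (k + M)%N)) => //.
  - by move=> k; exact: lu.
  - exact: (lu n).1.
  - by apply: filterS vf => x; rewrite -[X in X -> _](@cvg_shiftn M).
  move=> k; apply/ltW; apply: HM => //.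
  by apply: leq_trans (ks _); rewrite leq_addl.
exists f; split => //.
have [M HM] := fin 1 ltr01.
rewrite (_ : f = (fun x => u M x - (u M x - f x))); last first.
  by apply/funext => x; rewrite opprB addrC subrK.
apply: l2B => //; split; first by apply: measurable_funB => //; exact: (lu M).1.
by apply: lt_trans (HM M (leqnn M)) _; rewrite ltry.
Qed.

End RieszFischer.

(** * The complex Hilbert space L^2 *)

Section HilbertSpace.
Context d (T : measurableType d) (R : realType) (m : {measure set T -> \bar R}).
Local Notation sqint := (sqint m).
Local Notation l2 := (l2 m).
Local Notation l2ip := (l2ip m).
Local Notation aeq := (aeq m).

(** The value 0 on arguments outside [l2] makes the functional depend only on the classes of [f] and
    [g]: pairings with nonmeasurable functions would not. *)
Definition l2functional (f g : T -> R) : (T -> R) -> R[i]^o :=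
  fun k => if `[< l2 k >] then Complex (l2ip f k) (l2ip g k) else 0.

Definition L2C_pred : {pred (T -> R) -> R[i]^o} :=
  [pred F | `[< exists f g, [/\ l2 f, l2 g & F = l2functional f g] >]].

Lemma l2functional_lin (a : R[i]) f g f' g' : l2 f -> l2 g -> l2 f' -> l2 g' ->
  a *: l2functional f g + l2functional f' g' =
  l2functional (fun x => complex.Re a * f x + (- complex.Im a * g x + f' x))
               (fun x => complex.Re a * g x + (complex.Im a * f x + g' x)).
Proof.
move=> lf lg lf' lg'; apply/funext => k; rewrite /l2functional /=.
rewrite -[LHS]/(a * (if `[< l2 k >] then _ else 0) + (if `[< l2 k >] then _ else 0)).
case: asboolP => lk; last by rewrite mulr0 addr0.
rewrite !l2ip_linl//; try exact: l2_lin.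
case: a => a b; rewrite /=; apply/eqP; rewrite eq_complex/=; apply/andP; split; apply/eqP; ring.
Qed.

Lemma L2C_submod : submod_closed L2C_pred.
Proof.
split=> [|a F G].
  apply/asboolP; exists (fun=> 0), (fun=> 0); split; try exact: l2_0.
  apply/funext => k; rewrite /l2functional; case: asboolP => // lk.
  by rewrite !l2ip0l.
move=> /asboolP[f [g [lf lg ->]]] /asboolP[f' [g' [lf' lg' ->]]].
apply/asboolP; eexists; eexists; split; last exact: l2functional_lin.
- by do 2 apply: l2_lin => //.
- by do 2 apply: l2_lin => //.
Qed.

HB.instance Definition _ := GRing.isSubmodClosed.Build _ _ L2C_pred L2C_submod.

(* An element of L^2(m; C) is represented by the functional it induces on the
   real functions of L^2: a subspace of a function space replaces the quotient
   by almost everywhere equality. *)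
Definition L2C := {F : (T -> R) -> R[i]^o | F \in L2C_pred}.

HB.instance Definition _ := [isSub of L2C for sval].
HB.instance Definition _ := [Choice of L2C by <:].
HB.instance Definition _ := [SubChoice_isSubLmodule of L2C by <:].

Lemma L2C_repr (x : L2C) :
  exists fg : (T -> R) * (T -> R), [/\ l2 fg.1, l2 fg.2 & sval x = l2functional fg.1 fg.2].
Proof. by case: x => F /= /asboolP[f [g H]]; exists (f, g). Qed.

Definition reK (x : L2C) : T -> R := (sval (cid (L2C_repr x))).1.
Definition imK (x : L2C) : T -> R := (sval (cid (L2C_repr x))).2.

Lemma re_l2 x : l2 (reK x). Proof. by rewrite /reK; case: cid => ? []. Qed.
Lemma im_l2 x : l2 (imK x). Proof. by rewrite /imK; case: cid => ? []. Qed.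
Lemma svalK x : sval x = l2functional (reK x) (imK x).
Proof. by rewrite /reK /imK; case: cid => ? []. Qed.
Hint Resolve re_l2 im_l2 : core.

Lemma l2functional_inj f g f' g' : l2 f -> l2 g -> l2 f' -> l2 g' ->
  l2functional f g = l2functional f' g' -> aeq f f' /\ aeq g g'.
Proof.
move=> lf lg lf' lg' E; split; apply: ip_ext_aeq => // k lk;
  by move: (congr1 (fun F => F k) E); rewrite /l2functional asboolT// => -[].
Qed.

Lemma l2functional_aeq f g f' g' : l2 f -> l2 g -> l2 f' -> l2 g' ->
  aeq f f' -> aeq g g' -> l2functional f g = l2functional f' g'.
Proof.
move=> [lf _] [lg _] [lf' _] [lg' _] ff gg; apply/funext => k; rewrite /l2functional.
case: asboolP => // -[mk _].
by rewrite (aeq_ipl _ _ _ ff)// (aeq_ipl _ _ _ gg).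
Qed.

Definition mkK (f g : T -> R) : L2C := insubd (0 : L2C) (l2functional f g).

Lemma val_mkK f g : l2 f -> l2 g -> sval (mkK f g) = l2functional f g.
Proof.
move=> lf lg; rewrite -[sval _]/(val _) /mkK insubdK//.
by apply/asboolP; exists f, g.
Qed.

Lemma re_mkK f g : l2 f -> l2 g -> aeq (reK (mkK f g)) f.
Proof.
move=> lf lg; have := val_mkK lf lg; rewrite svalK.
by move=> /l2functional_inj[].
Qed.

Lemma im_mkK f g : l2 f -> l2 g -> aeq (imK (mkK f g)) g.
Proof.
move=> lf lg; have := val_mkK lf lg; rewrite svalK.
by move=> /l2functional_inj[].
Qed.

Lemma K_ext x y : aeq (reK x) (reK y) -> aeq (imK x) (imK y) -> x = y.
Proof. by move=> rr ii; apply: val_inj; rewrite /= !svalK; exact: l2functional_aeq. Qed.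

Lemma mkK_aeq f g f' g' : l2 f -> l2 g -> l2 f' -> l2 g' ->
  aeq f f' -> aeq g g' -> mkK f g = mkK f' g'.
Proof. by move=> *; congr insubd; exact: l2functional_aeq. Qed.

Lemma mkK_lin (a : R[i]) f g f' g' : l2 f -> l2 g -> l2 f' -> l2 g' ->
  a *: mkK f g + mkK f' g' =
  mkK (fun x => complex.Re a * f x + (- complex.Im a * g x + f' x))
      (fun x => complex.Re a * g x + (complex.Im a * f x + g' x)).
Proof.
move=> *; apply: val_inj; rewrite /= !val_mkK//; try by do 2 apply: l2_lin => //.
by rewrite -l2functional_lin.
Qed.

Lemma KE x : x = mkK (reK x) (imK x).
Proof. by apply: val_inj; rewrite /= val_mkK// svalK. Qed.

Lemma re_lin (a : R[i]) x y : aeq (reK (a *: x + y))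
  (fun t => complex.Re a * reK x t + (- complex.Im a * imK x t + reK y t)).
Proof.
rewrite {1}(KE x) {1}(KE y) mkK_lin//; apply: re_mkK; by do 2 apply: l2_lin => //.
Qed.

Lemma im_lin (a : R[i]) x y : aeq (imK (a *: x + y))
  (fun t => complex.Re a * imK x t + (complex.Im a * reK x t + imK y t)).
Proof.
rewrite {1}(KE x) {1}(KE y) mkK_lin//; apply: im_mkK; by do 2 apply: l2_lin => //.
Qed.

Lemma re_sub x y : aeq (reK (x - y)) (fun t => reK x t - reK y t).
Proof.
rewrite addrC -scaleN1r; apply: aeq_trans (re_lin _ _ _) _.
by apply: aeW => t /=; ring.
Qed.

Lemma im_sub x y : aeq (imK (x - y)) (fun t => imK x t - imK y t).
Proof.
rewrite addrC -scaleN1r; apply: aeq_trans (im_lin _ _ _) _.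
by apply: aeW => t /=; ring.
Qed.

Lemma re_0 : aeq (reK 0) (fun=> 0).
Proof. by have := re_sub 0 0; rewrite subrr; apply: filterS => t ->; rewrite subrr. Qed.

Lemma im_0 : aeq (imK 0) (fun=> 0).
Proof. by have := im_sub 0 0; rewrite subrr; apply: filterS => t ->; rewrite subrr. Qed.

(** The integral of (f + ig) times the conjugate of (f' + ig'), split into real and imaginary
    parts. *)
Definition ipK (x y : L2C) : R[i] :=
  Complex (l2ip (reK x) (reK y) + l2ip (imK x) (imK y))
          (l2ip (imK x) (reK y) - l2ip (reK x) (imK y)).

Lemma knorm2E x : (knorm2 ipK x)%:E = (sqint (reK x) + sqint (imK x))%E.
Proof. by rewrite /knorm2/= EFinD !l2ip_self. Qed.

Lemma knorm2BE x y : (knorm2 ipK (x - y))%:E =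
  (sqint (fun t => reK x t - reK y t)%R + sqint (fun t => imK x t - imK y t)%R)%E.
Proof.
rewrite knorm2E; congr (_ + _)%E; apply: aeq_sqint.
- exact: (re_l2 _).1.
- exact: (l2B (re_l2 _) (re_l2 _)).1.
- exact: re_sub.
- exact: (im_l2 _).1.
- exact: (l2B (im_l2 _) (im_l2 _)).1.
- exact: im_sub.
Qed.

Lemma re_kconv u x : kconv ipK u x -> forall e : R, 0 < e -> exists M, forall n, (M <= n)%N ->
  (sqint (fun t => reK (u n) t - reK x t)%R < e%:E)%E.
Proof.
move=> ux e e0; have [M HM] := ux e e0; exists M => n /HM.
rewrite -lte_fin knorm2BE; apply: le_lt_trans.
by rewrite leeDl// sqint_ge0.
Qed.

Lemma im_kconv u x : kconv ipK u x -> forall e : R, 0 < e -> exists M, forall n, (M <= n)%N ->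
  (sqint (fun t => imK (u n) t - imK x t)%R < e%:E)%E.
Proof.
move=> ux e e0; have [M HM] := ux e e0; exists M => n /HM.
rewrite -lte_fin knorm2BE; apply: le_lt_trans.
by rewrite leeDr// sqint_ge0.
Qed.

Lemma ipK_hilbert : is_hilbert ipK.
Proof.
have ael f g k : l2 f -> l2 g -> l2 k -> aeq f g -> l2ip f k = l2ip g k.
  by move=> [? _] [? _] [? _] ?; exact: aeq_ipl.
split.
- move=> a x y z; rewrite /ipK.
  rewrite !(ael _ _ _ _ _ _ (re_lin a x y)) ?(ael _ _ _ _ _ _ (im_lin a x y))//;
    try by do 2 apply: l2_lin => //.
  rewrite !l2ip_linl//; try exact: l2_lin.
  case: a => a b; apply/eqP; rewrite eq_complex/=; apply/andP; split; apply/eqP; ring.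
- move=> x y; apply/eqP; rewrite eq_complex /ipK /=.
  rewrite ![l2ip (reK y) _]l2ipC ![l2ip (imK y) _]l2ipC opprB !eqxx//.
- by move=> x; rewrite -lee_fin knorm2E adde_ge0// sqint_ge0.
- move=> x /(congr1 (@EFin R)); rewrite knorm2E => /eqP.
  rewrite padde_eq0 ?sqint_ge0// => /andP[/eqP r0 /eqP i0].
  apply: K_ext.
    by apply: aeq_trans (sqint0_ae (re_l2 x).1 r0) _; apply: aeq_sym; exact: re_0.
  by apply: aeq_trans (sqint0_ae (im_l2 x).1 i0) _; apply: aeq_sym; exact: im_0.
- move=> u cu.
  have [||f [lf uf]] := @l2_complete _ _ _ m (fun n => reK (u n)).
  + by [].
  + move=> e e0; have [M HM] := cu e e0; exists M => i j Mi Mj.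
    have := HM i j Mi Mj; rewrite -lte_fin knorm2BE; apply: le_lt_trans.
    by rewrite leeDl// sqint_ge0.
  have [||g [lg ug]] := @l2_complete _ _ _ m (fun n => imK (u n)).
  + by [].
  + move=> e e0; have [M HM] := cu e e0; exists M => i j Mi Mj.
    have := HM i j Mi Mj; rewrite -lte_fin knorm2BE; apply: le_lt_trans.
    by rewrite leeDr// sqint_ge0.
  exists (mkK f g) => e e0.
  have [M1 H1] := uf (e / 2) (divr_gt0 e0 (ltr0Sn _ 1)).
  have [M2 H2] := ug (e / 2) (divr_gt0 e0 (ltr0Sn _ 1)).
  exists (maxn M1 M2) => n; rewrite geq_max => /andP[/H1 h1 /H2 h2].
  rewrite -lte_fin knorm2BE [e]splitr EFinD; apply: lteD.
    rewrite (le_lt_trans _ h1)// (@aeq_sqint _ _ _ _ _ (fun t => reK (u n) t - f t))//.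
    + exact: (l2B (re_l2 _) (re_l2 _)).1.
    + exact: (l2B (re_l2 _) lf).1.
    + by have := re_mkK lf lg; apply: filterS => t ->.
  rewrite (le_lt_trans _ h2)// (@aeq_sqint _ _ _ _ _ (fun t => imK (u n) t - g t))//.
  + exact: (l2B (im_l2 _) (im_l2 _)).1.
  + exact: (l2B (im_l2 _) lg).1.
  + by have := im_mkK lf lg; apply: filterS => t ->.
Qed.

End HilbertSpace.
#[global] Hint Resolve re_l2 im_l2 : core.

(** * Composition with a bijection whose Jacobian is constant along orbits *)

Section Truncation.
Context d (T : measurableType d) (R : realType) (m : {measure set T -> \bar R}).
Local Notation sqint := (sqint m).
Local Notation l2 := (l2 m).
Local Notation l2ip := (l2ip m).
Local Notation aeq := (aeq m).

Definition l2cvg (u : nat -> T -> R) (f : T -> R) := forall e : R, 0 < e ->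
  exists M, forall n, (M <= n)%N -> (sqint (fun x => u n x - f x)%R < e%:E)%E.

Lemma l2cvg_ip_lt (a f : T -> R) u : l2 a -> l2 f -> (forall n, l2 (u n)) ->
  l2cvg u f -> forall e : R, 0 < e -> exists M, forall n, (M <= n)%N ->
  `|l2ip a (u n) - l2ip a f| < e.
Proof.
move=> la lf lu uf e e0.
have a1 : 0 < l2ip a a + 1 by rewrite ltr_wpDl ?l2ip_self_ge0.
(* Cauchy-Schwarz multiplies this bound by <a, a>, which leaves less than e^2; the added 1 keeps the
   denominator positive when [a] is null. *)
have [M HM] := uf (e ^+ 2 / (l2ip a a + 1)) (divr_gt0 (exprn_gt0 _ e0) a1).
exists M => n /HM; rewrite -l2ip_self; last exact: l2B.
rewrite lte_fin ltr_pdivlMr// => H.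
rewrite -l2ipBr// -(ltr_pXn2r (n:=2))// ?nnegrE ?(ltW e0)//.
rewrite real_normK ?num_real//.
apply: le_lt_trans (l2ip_CS la (l2B (lu n) lf)) _.
apply: le_lt_trans H; rewrite mulrC.
by apply: ler_wpM2l; [exact: l2ip_self_ge0|rewrite lerDl].
Qed.

Lemma l2cvg_ip_eq (a b f g : T -> R) u v : l2 a -> l2 b -> l2 f -> l2 g ->
  (forall n, l2 (u n)) -> (forall n, l2 (v n)) -> l2cvg u f -> l2cvg v g ->
  (forall n, l2ip a (u n) = l2ip b (v n)) -> l2ip a f = l2ip b g.
Proof.
move=> la lb lf lg lu lv uf vg E; apply/eqP; rewrite -subr_eq0; apply/negPn/negP => ne.
have e0 : 0 < `|l2ip a f - l2ip b g| / 2 by rewrite divr_gt0// normr_gt0.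
have [M1 H1] := l2cvg_ip_lt la lf lu uf e0.
have [M2 H2] := l2cvg_ip_lt lb lg lv vg e0.
have := H1 _ (leq_maxl M1 M2); have := H2 _ (leq_maxr M1 M2).
rewrite E; set p := l2ip b (v _); set x := l2ip a f; set y := l2ip b g => h1 h2.
have : `|x - y| <= `|p - y| + `|p - x|.
  by rewrite [X in _ <= _ + X]distrC (_ : x - y = (p - y) + (x - p)) ?ler_normD//; ring.
move: h1 h2; rewrite -/x -/y; lra.
Qed.

(* The maximality argument behind self-adjointness: a formal adjoint pair that
   is bounded on each spectral slice E n is a genuine adjoint pair. *)
Lemma formal_adjoint_max (E : nat -> T -> R) (A A' : (T -> R) -> T -> R) :
  (forall n, measurable_fun setT (E n)) ->
  (forall n x, E n x = 0 \/ E n x = 1) -> (forall x, exists n, E n x = 1) ->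
  (forall f, measurable_fun setT f -> measurable_fun setT (A' f)) ->
  (forall n f, l2 f -> l2 (A (fun x => E n x * f x))) ->
  (forall n f, l2 f -> l2 (fun x => E n x * A' f x)) ->
  (forall f g, measurable_fun setT f -> measurable_fun setT g ->
     l2ip (A f) g = l2ip f (A' g)) ->
  forall g k, l2 g -> l2 k ->
  (forall f, l2 f -> l2 (A f) -> l2ip (A f) g = l2ip f k) -> aeq (A' g) k.
Proof.
move=> mE E01 Ecov mA' trA trA' adj g k lg lk H.
have EE n x : E n x * E n x = E n x by case: (E01 n x) => ->; rewrite ?mulr0 ?mulr1.
have lEk n : l2 (fun x => E n x * k x).
  split; first by apply: measurable_funM => //; exact: lk.1.
  apply: le_lt_trans lk.2; apply: sqint_le.
  - by apply: measurable_funM => //; exact: lk.1.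
  - exact: lk.1.
  - by move=> x; case: (E01 n x) => ->; rewrite ?mul0r ?mul1r// expr0n/= sqr_ge0.
have D0 n : aeq (fun x => E n x * k x) (fun x => E n x * A' g x).
  (* The difference cut to slice [n] lies in the domain of [A], so it is an admissible test
     function; pairing it with the hypothesis gives <D, D> = 0. *)
  pose D x := E n x * k x - E n x * A' g x.
  have lD : l2 D by apply: l2B => //; exact: trA'.
  have ED x : E n x * D x = D x by rewrite /D mulrBr !mulrA EE.
  have lAD : l2 (A D).
    by rewrite (_ : D = (fun x => E n x * D x)); [exact: trA|apply/funext].
  have ipE f : l2ip D (fun x => E n x * f x) = l2ip D f.
    by apply: eq_Rintegral => x _; rewrite -{2}(ED x); ring.
  have := H D lD lAD; rewrite adj; [|exact: lD.1|exact: lg.1].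
  rewrite -ipE -[RHS]ipE => /eqP; rewrite eq_sym -subr_eq0 -l2ipBr//; last exact: trA'.
  move=> /eqP DD0; apply: sqintB0_aeq; [exact: (lEk n).1|exact: (trA' n g lg).1|].
  by rewrite -[LHS]/(sqint D) -l2ip_self// DD0.
have : {ae m, forall x, forall n, E n x * k x = E n x * A' g x}.
  exact: ae_foralln.
by apply: filterS => x Hx; have [n En] := Ecov x; have := Hx n; rewrite En !mul1r.
Qed.

End Truncation.

(** * The normal operator of composition with [Phi] *)

Section NormalComposition.
Context d (T : measurableType d) (R : realType) (m : {measure set T -> \bar R}).
Local Notation sqint := (sqint m).
Local Notation l2 := (l2 m).
Local Notation l2ip := (l2ip m).
Local Notation aeq := (aeq m).
Variables (Phi Psi : T -> T) (h : T -> R).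
Hypotheses (mPhi : measurable_fun setT Phi) (mPsi : measurable_fun setT Psi).
Hypotheses (PhiK : cancel Phi Psi) (PsiK : cancel Psi Phi).
Hypotheses (mh : measurable_fun setT h) (h0 : forall x, 0 < h x).
Hypothesis (hPhi : forall x, h (Phi x) = h x).
Hypothesis (cov : forall F : T -> \bar R, measurable_fun setT F -> (forall x, (0 <= F x)%E) ->
  (\int[m]_x F (Phi x) = \int[m]_x ((h x)%:E * F x))%E).

Definition compo (f : T -> R) : T -> R := fun x => f (Phi x).
Definition compo_adj (f : T -> R) : T -> R := fun x => h x * f (Psi x).
Local Notation A := compo.
Local Notation A' := compo_adj.

(** A spectral projection of N^* N, which is multiplication by [h]. Invariance of [h] under [Phi]
    and [Psi] makes it commute with [A] and [A'], and both are bounded on its range. *)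
Definition slice (n : nat) (x : T) : R := (h x <= n%:R)%R%:R.
Local Notation E := slice.

Let hPsi x : h (Psi x) = h x. Proof. by rewrite -hPhi PsiK. Qed.

Lemma measurable_compo f : measurable_fun setT f -> measurable_fun setT (A f).
Proof. by move=> mf; exact: measurableT_comp. Qed.

Lemma measurable_compo_adj f : measurable_fun setT f -> measurable_fun setT (A' f).
Proof. by move=> mf; apply: measurable_funM => //; exact: measurableT_comp. Qed.

Lemma measurable_slice n : measurable_fun setT (E n).
Proof.
rewrite (_ : E n = (fun x => if h x <= n%:R then 1 else 0)); last first.
  by apply/funext => x; rewrite /E; case: ifP.
by apply: measurable_fun_ifT => //; exact: measurable_fun_ler.
Qed.

Lemma slice01 n x : E n x = 0 \/ E n x = 1.
Proof. by rewrite /E; case: (_ <= _); [right|left]. Qed.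

Lemma slice_cover x : exists n, E n x = 1.
Proof.
exists (Num.truncn (h x)).+1.
by rewrite /E (ltW (truncnS_gt _)).
Qed.

Lemma slice_Phi n x : E n (Phi x) = E n x. Proof. by rewrite /E hPhi. Qed.
Lemma slice_Psi n x : E n (Psi x) = E n x. Proof. by rewrite /E hPsi. Qed.

Lemma sqint_compo f : measurable_fun setT f ->
  sqint (A f) = (\int[m]_x ((h x)%:E * (f x ^+ 2)%:E))%E.
Proof.
move=> mf; rewrite /sqint -(@cov (fun x => (f x ^+ 2)%:E))//; first exact: measurable_sq.
by move=> x; rewrite lee_fin sqr_ge0.
Qed.

(** This is |N^* f| = |N f|: both squares are int h f^2, the first by [cov] applied to h (f o
    Psi)^2. Hence N and its adjoint have the same domain. *)
Lemma sqint_compo_adj f : measurable_fun setT f -> sqint (A' f) = sqint (A f).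
Proof.
move=> mf; rewrite sqint_compo//.
transitivity (\int[m]_x ((h x)%:E * (h x * f (Psi x) ^+ 2)%:E))%E.
  by apply: eq_integral => x _; rewrite -EFinM /A'; congr EFin; ring.
rewrite -(@cov (fun x => (h x * f (Psi x) ^+ 2)%:E)).
- by apply: eq_integral => x _; rewrite hPhi PhiK EFinM.
- apply/measurable_EFinP; apply: measurable_funM => //; apply: measurable_funX.
  exact: measurableT_comp.
- by move=> x; rewrite lee_fin mulr_ge0 ?sqr_ge0// ltW.
Qed.

Lemma l2_compo_adj f : measurable_fun setT f -> l2 (A' f) <-> l2 (A f).
Proof.
move=> mf; rewrite /l2 sqint_compo_adj//; split=> -[_ H]; split => //.
  exact: measurable_compo.
exact: measurable_compo_adj.
Qed.

Lemma sqint_compo_slice n f : measurable_fun setT f ->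
  (sqint (A (fun x => E n x * f x)%R) <= n%:R%:E * sqint f)%E.
Proof.
move=> mf; have mEf : measurable_fun setT (fun x => E n x * f x).
  by apply: measurable_funM => //; exact: measurable_slice.
rewrite sqint_compo// /sqint -ge0_integralZl//; last 2 first.
- exact: measurable_sq.
- by move=> x _; rewrite lee_fin sqr_ge0.
apply: ge0_le_integral => //.
- by move=> x _; rewrite -EFinM lee_fin mulr_ge0 ?sqr_ge0// ltW.
- by apply: emeasurable_funM; [exact/measurable_EFinP|exact: measurable_sq].
- by apply: emeasurable_funM => //; exact: measurable_sq.
- move=> x _; rewrite -!EFinM lee_fin exprMn /E.
  have [H|H] := boolP (h x <= n%:R); rewrite ?expr1n ?expr0n/= ?mul1r ?mul0r ?mulr0.
    by rewrite ler_wpM2r ?sqr_ge0.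
  by rewrite mulr_ge0 ?sqr_ge0.
Qed.

Lemma l2_compo_slice n f : l2 f -> l2 (A (fun x => E n x * f x)).
Proof.
move=> [mf qf]; split.
  apply: measurable_compo; apply: measurable_funM => //; exact: measurable_slice.
apply: le_lt_trans (sqint_compo_slice _ mf) _.
by rewrite lte_mul_pinfty// lee_fin.
Qed.

Lemma l2_compo_adj_slice n f : l2 f -> l2 (A' (fun x => E n x * f x)).
Proof.
move=> lf; apply/l2_compo_adj; last exact: l2_compo_slice.
by apply: measurable_funM; [exact: measurable_slice|exact: lf.1].
Qed.

(** No integrability is assumed: [cov] matches the positive and the negative parts as extended
    integrals, so the two sides agree before [fine] is taken. *)
Lemma Rintegral_compo (F : T -> R) : measurable_fun setT F ->
  Rintegral m setT (fun x => F (Phi x)) = Rintegral m setT (fun x => h x * F x).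
Proof.
move=> mF; congr fine; rewrite integralE [RHS]integralE.
have mEF : measurable_fun setT (EFin \o F) by exact/measurable_EFinP.
congr (_ - _)%E.
- transitivity (\int[m]_x ((EFin \o F)^\+ (Phi x)))%E.
    by apply: eq_integral => x _; rewrite !(funeposE, funenegE).
  rewrite (@cov (EFin \o F)^\+%E); [|exact: measurable_funepos|by move=> x; exact: funepos_ge0].
  apply: eq_integral => x _; rewrite !funeposE/= -!EFin_max -EFinM.
  by rewrite maxr_pMr ?mulr0// ltW.
- transitivity (\int[m]_x ((EFin \o F)^\- (Phi x)))%E.
    by apply: eq_integral => x _; rewrite !(funeposE, funenegE).
  rewrite (@cov (EFin \o F)^\-%E); [|exact: measurable_funeneg|by move=> x; exact: funeneg_ge0].
  apply: eq_integral => x _; rewrite !funenegE/= -!EFin_max -EFinM.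
  by rewrite maxr_pMr ?mulr0 ?mulrN// ltW.
Qed.

Lemma compo_adjointness f g : measurable_fun setT f -> measurable_fun setT g ->
  l2ip (A f) g = l2ip f (A' g).
Proof.
move=> mf mg; transitivity (Rintegral m setT (fun x => f (Phi x) * g (Psi (Phi x)))).
  by apply: eq_Rintegral => x _; rewrite PhiK.
rewrite (@Rintegral_compo (fun x => f x * g (Psi x))).
  by apply: eq_Rintegral => x _; rewrite /A'; ring.
by apply: measurable_funM => //; exact: measurableT_comp.
Qed.

Lemma compo_adj_max g k : l2 g -> l2 k ->
  (forall f, l2 f -> l2 (A f) -> l2ip (A f) g = l2ip f k) -> aeq (A' g) k.
Proof.
apply: (formal_adjoint_max measurable_slice slice01 slice_cover).
- exact: measurable_compo_adj.
- exact: l2_compo_slice.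
- move=> n f lf; rewrite (_ : (fun _ => _) = A' (fun x => E n x * f x)).
    exact: l2_compo_adj_slice.
  by apply/funext => x; rewrite /A' slice_Psi; ring.
- exact: compo_adjointness.
Qed.

(** The maximality argument with the two operators exchanged: N is the adjoint of N^*. Closedness of
    N rests on this. *)
Lemma compo_max g k : l2 g -> l2 k ->
  (forall f, l2 f -> l2 (A' f) -> l2ip (A' f) g = l2ip f k) -> aeq (A g) k.
Proof.
apply: (formal_adjoint_max measurable_slice slice01 slice_cover).
- exact: measurable_compo.
- exact: l2_compo_adj_slice.
- move=> n f lf; rewrite (_ : (fun _ => _) = A (fun x => E n x * f x)).
    exact: l2_compo_slice.
  by apply/funext => x; rewrite /A /compo slice_Phi.
- by move=> f g' mf mg; rewrite l2ipC -compo_adjointness// l2ipC.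
Qed.

(** [Phi] pulls null sets back to null sets: by [cov], the squared distance of the compositions is
    int h (f - g)^2 = 0. *)
Lemma compo_aeq f g : measurable_fun setT f -> measurable_fun setT g ->
  aeq f g -> aeq (A f) (A g).
Proof.
move=> mf mg fg; apply: sqintB0_aeq; [exact: measurable_compo|exact: measurable_compo|].
have mfg : measurable_fun setT (fun x => f x - g x) by exact: measurable_funB.
rewrite -[LHS]/(sqint (A (fun x => f x - g x))) sqint_compo//.
rewrite -[RHS](integral0 m setT); apply: ae_eq_integral => //.
  by apply: emeasurable_funM; [exact/measurable_EFinP|exact: measurable_sq].
by apply: filterS fg => x -> _; rewrite subrr expr0n/= mule0.
Qed.

Lemma compo_adj_aeq f g : measurable_fun setT f -> measurable_fun setT g ->
  aeq f g -> aeq (A' f) (A' g).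
Proof.
move=> mf mg fg.
have mfg : measurable_fun setT (fun x => f x - g x) by exact: measurable_funB.
apply: sqintB0_aeq; [exact: measurable_compo_adj|exact: measurable_compo_adj|].
rewrite (_ : (fun _ => _) = A' (fun x => f x - g x)); last first.
  by apply/funext => x; rewrite /A'; ring.
rewrite sqint_compo_adj//.
apply: ae0_sqint; first exact: measurable_compo.
have : aeq (fun x => f x - g x) (fun=> 0) by apply: filterS fg => x ->; rewrite subrr.
by move/(compo_aeq mfg (@measurable_cst _ _ _ _ _ _)).
Qed.

(** Dominated convergence with dominating function f^2: at each point the truncation is eventually
    equal to [f]. *)
Lemma slice_dense f : l2 f -> l2cvg m (fun n x => E n x * f x) f.
Proof.
move=> [mf qf] e e0.
have if2 : m.-integrable setT (fun x => (f x ^+ 2)%:E).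
  apply/integrableP; split; first exact: measurable_sq.
  by under eq_integral => x _ do rewrite gee0_abs ?lee_fin ?sqr_ge0//.
have mD n : measurable_fun setT (fun x => E n x * f x - f x).
  by apply: measurable_funB => //; apply: measurable_funM => //; exact: measurable_slice.
have [||||_ _] := @dominated_convergence _ _ _ m setT measurableT
  (fun n x => ((E n x * f x - f x) ^+ 2)%:E) (cst 0%E) _ _ _ _ if2 _.
- by move=> n; exact: measurable_sq.
- exact: measurable_cst.
- apply: aeW => x _; apply: cvg_near_cst; exists (Num.truncn (h x)).+1 => // n /= hn.
  rewrite /E (_ : h x <= n%:R) ?mul1r ?subrr ?expr0n//.
  by apply: le_trans (ltW (truncnS_gt _)) _; rewrite ler_nat.
- apply: aeW => x n _; rewrite gee0_abs ?lee_fin ?sqr_ge0//.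
  by case: (slice01 n x) => ->; rewrite ?mul0r ?mul1r ?sub0r ?sqrrN ?subrr// expr0n/= sqr_ge0.
rewrite integral0 => /fine_cvgP[fi] /cvgr_dist_lt /(_ e e0) H.
have [M _ HM] := filterI fi H; exists M => n Mn.
have [/= fin] := HM n Mn; rewrite sub0r normrN.
rewrite ger0_norm; last by apply: fine_ge0; apply: integral_ge0 => x _; rewrite lee_fin sqr_ge0.
by rewrite -lte_fin fineK.
Qed.

Definition compo_dom : set (L2C m) := [set x | l2 (A (reK x)) /\ l2 (A (imK x))].
Definition compoK (x : L2C m) : L2C m := mkK m (A (reK x)) (A (imK x)).

Let l2A_lin f g f' a b c : l2 f -> l2 g -> l2 f' ->
  l2 (A f) -> l2 (A g) -> l2 (A f') ->
  measurable_fun setT c -> aeq c (fun x => a * f x + (b * g x + f' x)) ->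
  l2 (A c) /\ aeq (A c) (fun x => a * A f x + (b * A g x + A f' x)).
Proof.
move=> lf lg lf' laf lag laf' mc cE.
have le : l2 (fun x => a * f x + (b * g x + f' x)) by do 2 apply: l2_lin => //.
have lae : l2 (A (fun x => a * f x + (b * g x + f' x))).
  by rewrite -[A _]/(fun x => a * A f x + (b * A g x + A f' x)); do 2 apply: l2_lin => //.
have ac := compo_aeq mc le.1 cE.
split; last exact: ac.
by apply: aeq_l2 lae (measurable_compo mc) (aeq_sym ac).
Qed.

Lemma compo_dom_mkK f g : l2 f -> l2 g -> l2 (A f) -> l2 (A g) -> compo_dom (mkK m f g).
Proof.
move=> lf lg laf lag; split.
  apply: aeq_l2 laf (measurable_compo (re_l2 _).1) _.
  by apply: compo_aeq (aeq_sym (re_mkK lf lg)); [exact: lf.1|exact: (re_l2 _).1].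
apply: aeq_l2 lag (measurable_compo (im_l2 _).1) _.
by apply: compo_aeq (aeq_sym (im_mkK lf lg)); [exact: lg.1|exact: (im_l2 _).1].
Qed.

Lemma compoK_mkK f g : l2 f -> l2 g -> l2 (A f) -> l2 (A g) ->
  compoK (mkK m f g) = mkK m (A f) (A g).
Proof.
move=> lf lg laf lag; have [l1 l2'] := compo_dom_mkK lf lg laf lag.
apply: mkK_aeq => //.
- by apply: compo_aeq (re_mkK lf lg); [exact: (re_l2 _).1|exact: lf.1].
- by apply: compo_aeq (im_mkK lf lg); [exact: (im_l2 _).1|exact: lg.1].
Qed.

Let re_compoK x : compo_dom x -> aeq (reK (compoK x)) (A (reK x)).
Proof. by move=> [? ?]; exact: re_mkK. Qed.
Let im_compoK x : compo_dom x -> aeq (imK (compoK x)) (A (imK x)).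
Proof. by move=> [? ?]; exact: im_mkK. Qed.

(** Identifies the adjoint with its full domain. One direction is the formal adjointness, the other
    is maximality, applied to real and imaginary parts separately. *)
Lemma adjrel_compoK g k : adjrel (@ipK _ _ _ m) compo_dom compoK g k <->
  aeq (A' (reK g)) (reK k) /\ aeq (A' (imK g)) (imK k).
Proof.
have ael f f' e : measurable_fun setT f -> measurable_fun setT f' -> measurable_fun setT e ->
  aeq f f' -> l2ip e f = l2ip e f'.
  by move=> ? ? ? ?; rewrite l2ipC [RHS]l2ipC; exact: aeq_ipl.
split=> [H|[rg ig] x Dx].
  suff HH f : l2 f -> l2 (A f) ->
      l2ip (A f) (reK g) = l2ip f (reK k) /\ l2ip (A f) (imK g) = l2ip f (imK k).
    by split; apply: compo_adj_max => // f lf laf; have [] := HH f lf laf.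
  move=> lf laf.
  have l0 := l2_0 m; have la0 : l2 (A (fun=> 0)) by exact: l0.
  (* A real test vector turns the two wanted pairings into the real part and, up to sign, the
     imaginary part of one equation. *)
  have := H _ (compo_dom_mkK lf l0 laf la0); rewrite compoK_mkK// /ipK.
  have ip1 f1 f2 e : l2 f1 -> l2 f2 -> l2 e -> l2ip (reK (mkK m f1 f2)) e = l2ip f1 e.
    move=> l1 l2' le; apply: aeq_ipl (re_mkK l1 l2'); [exact: (re_l2 _).1|exact: l1.1|exact: le.1].
  have ip2 f1 f2 e : l2 f1 -> l2 f2 -> l2 e -> l2ip (imK (mkK m f1 f2)) e = l2ip f2 e.
    move=> l1 l2' le; apply: aeq_ipl (im_mkK l1 l2'); [exact: (im_l2 _).1|exact: l2'.1|exact: le.1].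
  rewrite !ip1// !ip2// -[A (fun=> 0)]/(fun=> 0) !l2ip0l !addr0 !sub0r.
  by move=> [-> /oppr_inj ->].
have [mrx mix] : measurable_fun setT (reK x) /\ measurable_fun setT (imK x).
  by split; [exact: (re_l2 _).1|exact: (im_l2 _).1].
have [mrg mig] : measurable_fun setT (reK g) /\ measurable_fun setT (imK g).
  by split; [exact: (re_l2 _).1|exact: (im_l2 _).1].
have [mrk mik] : measurable_fun setT (reK k) /\ measurable_fun setT (imK k).
  by split; [exact: (re_l2 _).1|exact: (im_l2 _).1].
have ipA e f f' f'' : measurable_fun setT e -> measurable_fun setT f ->
    measurable_fun setT f' -> measurable_fun setT f'' ->
    aeq e (A f) -> aeq (A' f') f'' -> l2ip e f' = l2ip f f''.
  move=> me mf mf' mf'' eA fA; rewrite (aeq_ipl me (measurable_compo mf) mf' eA).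
  by rewrite compo_adjointness//; apply: ael => //; exact: measurable_compo_adj.
have rN := re_compoK Dx; have iN := im_compoK Dx.
have mrN := (re_l2 (compoK x)).1; have miN := (im_l2 (compoK x)).1.
rewrite /ipK; congr Complex.
  by congr (_ + _); [exact: ipA rN rg|exact: ipA iN ig].
by congr (_ - _); [exact: ipA iN rg|exact: ipA rN ig].
Qed.

Lemma compoK_normal : is_normal (@ipK _ _ _ m) compo_dom compoK.
Proof.
have mre (x : L2C m) := (re_l2 x).1; have mim (x : L2C m) := (im_l2 x).1.
have Dlin (a : R[i]) f g : compo_dom f -> compo_dom g -> compo_dom (a *: f + g).
  move=> [rf jf] [rg jg]; split.
    exact: (l2A_lin (re_l2 f) (im_l2 f) (re_l2 g) rf jf rg (mre _) (re_lin a f g)).1.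
  exact: (l2A_lin (im_l2 f) (re_l2 f) (im_l2 g) jf rf jg (mim _) (im_lin a f g)).1.
split.
- split=> //; split.
    apply: aeq_l2 (l2_0 m) (measurable_compo (mre _)) _.
    exact: (compo_aeq (@measurable_cst _ _ _ _ _ _) (mre _) (aeq_sym (@re_0 _ _ _ m))).
  apply: aeq_l2 (l2_0 m) (measurable_compo (mim _)) _.
  exact: (compo_aeq (@measurable_cst _ _ _ _ _ _) (mim _) (aeq_sym (@im_0 _ _ _ m))).
- move=> a f g Df Dg; have Dag := Dlin a _ _ Df Dg.
  rewrite /compoK mkK_lin//; try (by case: Df); try (by case: Dg).
  case: Df Dg Dag => [rf jf] [rg jg] [ra ja].
  apply: mkK_aeq => //; try (by do 2 apply: l2_lin => //).
    exact: (l2A_lin (re_l2 f) (im_l2 f) (re_l2 g) rf jf rg (mre _) (re_lin a f g)).2.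
  exact: (l2A_lin (im_l2 f) (re_l2 f) (im_l2 g) jf rf jg (mim _) (im_lin a f g)).2.
- move=> f e e0.
  have e20 : 0 < e / 2 by rewrite divr_gt0.
  have [M1 H1] := slice_dense (re_l2 f) e20.
  have [M2 H2] := slice_dense (im_l2 f) e20.
  pose n := maxn M1 M2.
  have lE k : l2 k -> l2 (fun x => E n x * k x).
    move=> [mk qk]; have mEk : measurable_fun setT (fun x => E n x * k x).
      by apply: measurable_funM => //; exact: measurable_slice.
    split => //; apply: le_lt_trans qk; apply: sqint_le => // x.
    by case: (slice01 n x) => ->; rewrite ?mul0r ?mul1r// expr0n/= sqr_ge0.
  have lr := lE _ (re_l2 f); have li := lE _ (im_l2 f).
  exists (mkK m (fun x => E n x * reK f x) (fun x => E n x * imK f x)); split.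
    by apply: compo_dom_mkK => //; exact: l2_compo_slice.
  rewrite -lte_fin knorm2BE [e]splitr EFinD; apply: lteD.
    rewrite (le_lt_trans _ (H1 n (leq_maxl _ _)))// sqintBC.
    rewrite le_eqVlt; apply/orP; left; apply/eqP/aeq_sqint.
    + exact: (l2B (re_l2 _) (re_l2 _)).1.
    + exact: (l2B lr (re_l2 _)).1.
    + by have := re_mkK lr li; apply: filterS => x ->.
  rewrite (le_lt_trans _ (H2 n (leq_maxr _ _)))// sqintBC.
    rewrite le_eqVlt; apply/orP; left; apply/eqP/aeq_sqint.
  + exact: (l2B (im_l2 _) (im_l2 _)).1.
  + exact: (l2B li (im_l2 _)).1.
  + by have := im_mkK lr li; apply: filterS => x ->.
- move=> u f g Du uf ug.
  (* Closedness, componentwise: the pairing of A (r n) with any [c] in the domain of [A'] passes to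
     the limit, and [compo_max] concludes. *)
  have clos (r : nat -> T -> R) a b : (forall n, l2 (r n)) -> (forall n, l2 (A (r n))) ->
      l2 a -> l2 b -> l2cvg m r a -> l2cvg m (fun n => A (r n)) b -> aeq (A a) b.
    move=> lr lAr la lb ra Arb; apply: compo_max => // c lc lAc.
    apply: (l2cvg_ip_eq lAc lc la lb lr lAr ra Arb) => n.
    by rewrite l2ipC -compo_adjointness; [exact: l2ipC|exact: (lr n).1|exact: lc.1].
  have cr : aeq (A (reK f)) (reK g).
    apply: (clos (fun n => reK (u n))) => //; first by move=> n; exact: (Du n).1.
      exact: re_kconv.
    move=> e e0; have [M HM] := re_kconv ug e0; exists M => n /HM.
    apply: le_lt_trans; rewrite le_eqVlt; apply/orP; left; apply/eqP/aeq_sqint.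
    + exact: (l2B (Du n).1 (re_l2 _)).1.
    + exact: (l2B (re_l2 _) (re_l2 _)).1.
    + by have := re_compoK (Du n); apply: filterS => x ->.
  have ci : aeq (A (imK f)) (imK g).
    apply: (clos (fun n => imK (u n))) => //; first by move=> n; exact: (Du n).2.
      exact: im_kconv.
    move=> e e0; have [M HM] := im_kconv ug e0; exists M => n /HM.
    apply: le_lt_trans; rewrite le_eqVlt; apply/orP; left; apply/eqP/aeq_sqint.
    + exact: (l2B (Du n).2 (im_l2 _)).1.
    + exact: (l2B (im_l2 _) (im_l2 _)).1.
    + by have := im_compoK (Du n); apply: filterS => x ->.
  have Df : compo_dom f.
    split; first exact: aeq_l2 (re_l2 g) (measurable_compo (mre f)) (aeq_sym cr).
    exact: aeq_l2 (im_l2 g) (measurable_compo (mim f)) (aeq_sym ci).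
  by split => //; rewrite (KE g); case: Df => ? ?; exact: mkK_aeq.
- move=> f k; split.
  + move=> [Df /adjrel_compoK[rk ik]].
    (* Both products of [A] and [A'] are multiplication by [h], pointwise; for A (A' b) this uses h
       (Phi x) = h x. *)
    have AA c b e : measurable_fun setT c -> measurable_fun setT b ->
        aeq c (A b) -> aeq (A' c) e -> aeq (A (A' b)) e.
      move=> mc mb cb ce; apply: aeq_trans ce.
      apply: aeq_trans (compo_adj_aeq (measurable_compo mb) mc (aeq_sym cb)).
      by apply: aeW => x; rewrite /A/compo/A' hPhi PhiK PsiK.
    have {}rk := AA _ _ _ (mre _) (mre f) (re_compoK Df) rk.
    have {}ik := AA _ _ _ (mim _) (mim f) (im_compoK Df) ik.
    have lr : l2 (A' (reK f)) by apply/l2_compo_adj => //; exact: Df.1.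
    have li : l2 (A' (imK f)) by apply/l2_compo_adj => //; exact: Df.2.
    have lrk : l2 (A (A' (reK f))).
      exact: aeq_l2 (re_l2 k) (measurable_compo lr.1) (aeq_sym rk).
    have lik : l2 (A (A' (imK f))).
      exact: aeq_l2 (im_l2 k) (measurable_compo li.1) (aeq_sym ik).
    (* The vector N^* f; it exists since [f] is in the domain of N, which is also the domain of the
       adjoint. *)
    exists (mkK m (A' (reK f)) (A' (imK f))); split.
      apply/adjrel_compoK; split; apply: aeq_sym; [exact: re_mkK|exact: im_mkK].
    split; first exact: compo_dom_mkK.
    by rewrite compoK_mkK// (KE k); exact: mkK_aeq.
  + move=> [k' [/adjrel_compoK[rk ik] [Dk Nk]]].
    have Df : compo_dom f.
      split; apply/l2_compo_adj => //.
        exact: aeq_l2 (re_l2 k') (measurable_compo_adj (mre f)) (aeq_sym rk).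
      exact: aeq_l2 (im_l2 k') (measurable_compo_adj (mim f)) (aeq_sym ik).
    split => //; apply/adjrel_compoK.
    have AA c b e : measurable_fun setT c -> measurable_fun setT b -> measurable_fun setT e ->
        aeq c (A b) -> aeq (A' b) e -> aeq (A' c) (A e).
      move=> mc mb me cb be; apply: aeq_trans (compo_aeq (measurable_compo_adj mb) me be).
      apply: aeq_trans (compo_adj_aeq mc (measurable_compo mb) cb) _.
      by apply: aeW => x; rewrite /A/compo/A' hPhi PhiK PsiK.
    split.
      apply: aeq_trans (AA _ _ _ (mre _) (mre f) (mre k') (re_compoK Df) rk) _.
      by rewrite -Nk; apply: aeq_sym; exact: re_compoK.
    apply: aeq_trans (AA _ _ _ (mim _) (mim f) (mim k') (im_compoK Df) ik) _.
    by rewrite -Nk; apply: aeq_sym; exact: im_compoK.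
Qed.

End NormalComposition.

(** * Spreading L^2(w) over cells of a measure space *)

Section Glue.
Context (T U : Type) (G : nat -> set T) (f : nat -> T -> U) (f0 : T -> U).
Hypothesis tG : trivIset setT G.

Definition glue (x : T) : U :=
  if pselect (exists n, G n x) is left e then f (sval (cid e)) x else f0 x.

Lemma trivIset_index_eq n k x : G n x -> G k x -> n = k.
Proof. by move=> Gn Gk; apply: (tG I I); exists x. Qed.

Lemma glueE n x : G n x -> glue x = f n x.
Proof.
move=> Gn; rewrite /glue; case: pselect => [e|[]]; last by exists n.
by case: cid => k Gk /=; rewrite (trivIset_index_eq Gk Gn).
Qed.

Lemma glueN x : ~ (exists n, G n x) -> glue x = f0 x.
Proof. by rewrite /glue; case: pselect. Qed.

End Glue.

Lemma measurable_glue d d' (T : measurableType d) (U : measurableType d')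
    (G : nat -> set T) (f : nat -> T -> U) (f0 : T -> U) :
  trivIset setT G -> (forall n, measurable (G n)) ->
  (forall n, measurable_fun setT (f n)) -> measurable_fun setT f0 ->
  measurable_fun setT (glue G f f0).
Proof.
move=> tG mG mf mf0 _ Y mY; rewrite setTI.
rewrite (_ : _ @^-1` Y = (\bigcup_n (G n `&` f n @^-1` Y)) `|`
    (~` (\bigcup_n G n) `&` f0 @^-1` Y)); last first.
  apply/seteqP; split => x /=.
    have [[n Gn]|nG] := pselect (exists n, G n x).
      by rewrite (glueE _ _ tG Gn) => fY; left; exists n.
    rewrite glueN// => fY; right; split => // -[n _ Gn]; apply: nG; by exists n.
  case=> [[n _ [Gn fY]]|[nG fY]]; first by rewrite (glueE _ _ tG Gn).
  by rewrite glueN// => -[n Gn]; apply: nG; exists n.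
apply: measurableU.
  apply: bigcup_measurable => n _; apply: measurableI => //.
  by rewrite -[X in measurable X]setTI; exact: mf.
apply: measurableI; first by apply: measurableC; exact: bigcup_measurable.
by rewrite -[X in measurable X]setTI; exact: mf0.
Qed.

(** * Density of the domain of the composition operator *)

Section WeightedL2.
Context (R : realType) (X : choiceType) (enum : nat -> X) (henum : bijective enum)
  (w : X -> R) (hw : forall x, 0 <= w x).

Lemma csq_ge0 (z : R[i]) : 0 <= csq z.
Proof. by rewrite /csq addr_ge0// sqr_ge0. Qed.

Lemma esum_enum (a : X -> \bar R) : (forall x, (0 <= a x)%E) ->
  (\esum_(x in [set: X]) a x = \sum_(0 <= n <oo) a (enum n))%E.
Proof.
move=> a0; rewrite nneseries_esumT//.
rewrite (@reindex_esum _ _ _ setT _ enum)//.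
by split => //; [move=> x y _ _; exact: bij_inj|move=> x _; have [g _ gK] := henum; exists (g x)].
Qed.

Lemma l2norm2E (f : X -> R[i]) :
  l2norm2 w f = (\sum_(0 <= n <oo) (w (enum n) * csq (f (enum n)))%:E)%E.
Proof. by rewrite /l2norm2 esum_enum// => x; rewrite lee_fin mulr_ge0// csq_ge0. Qed.

Variable phi : X -> X.
Hypotheses (ha : forall x, w x = 0 <-> wmeasure w (phi @^-1` [set x]) = 0%E)
  (hb : forall x, 0 < w x -> (wmeasure w (phi @^-1` [set x]) < +oo)%E).

Lemma wmeasure_fiber_lty x : (wmeasure w (phi @^-1` [set x]) < +oo)%E.
Proof.
have [w0|] := eqVneq (w x) 0; first by rewrite (ha x).1// ltry.
by move=> w0; apply: hb; rewrite lt_neqAle eq_sym w0 hw.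
Qed.

(** Truncating [f] to the first [N] points of the enumeration makes the error a tail of a convergent
    series. The composed truncation has norm squared equal to a sum over [N] fibers, each of finite
    measure. *)
Lemma dom_Cphi_dense f : inL2 w f -> forall e : R, 0 < e ->
  exists g, dom_Cphi w phi g /\ (l2norm2 w (fun x => (f x - g x)%R) < e%:E)%E.
Proof.
move=> lf e e0.
have [r rK Kr] := henum.
have csq0 : csq (0 : R[i]) = 0 by rewrite /csq/= expr0n/= addr0.
have t0 k : (0 <= (w (enum k) * csq (f (enum k)))%:E)%E.
  by rewrite lee_fin mulr_ge0// csq_ge0.
have := @nneseries_tail_cvg R (fun n => (w (enum n) * csq (f (enum n)))%:E) xpredT.
rewrite -l2norm2E => /(_ lf (fun k _ => t0 k)) /fine_cvgP[fi] /cvgr_dist_lt /(_ e e0) H.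
have [N _ /(_ N (leqnn N))] := filterI fi H.
move=> [/= fin]; rewrite sub0r normrN ger0_norm ?fine_ge0 ?nneseries_ge0// => He.
have {He} He : (\sum_(N <= k <oo) (w (enum k) * csq (f (enum k)))%:E < e%:E)%E.
  by rewrite -(fineK fin) lte_fin.
pose g x := if (r x < N)%N then f x else 0.
exists g; split; last first.
  rewrite l2norm2E (@nneseries_split _ _ 0 N); last first.
    by move=> k _; rewrite lee_fin mulr_ge0// csq_ge0.
  rewrite add0n big_nat big1 ?add0e; last first.
    by move=> k /andP[_ kN]; rewrite /g rK kN subrr csq0 mulr0.
  apply: le_lt_trans He; apply: lee_nneseries => k.
    by rewrite lee_fin mulr_ge0// csq_ge0.
  by move=> _; rewrite lee_fin /g rK; case: ifP; rewrite ?subr0//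
    subrr csq0 mulr0 mulr_ge0// csq_ge0.
split.
  rewrite /inL2 l2norm2E; apply: le_lt_trans lf; rewrite l2norm2E.
  apply: lee_nneseries => k; first by rewrite lee_fin mulr_ge0// csq_ge0.
  by move=> _; rewrite lee_fin /g rK; case: ifP => // _; rewrite csq0 mulr0 mulr_ge0// csq_ge0.
rewrite /inL2 l2norm2E.
(* The contribution of the point [enum n] to the measure of the fiber over [enum i]. *)
pose a n i := if phi (enum n) == enum i then (w (enum n))%:E else 0%E.
have a0 n i : (0 <= a n i)%E by rewrite /a; case: ifP; rewrite // lee_fin.
rewrite (eq_eseriesr (g := fun n => (\sum_(0 <= i < N) (csq (f (enum i)))%:E * a n i)%E)); last first.
  move=> n _; rewrite /comp.
  have [gN|gN] := ltnP (r (phi (enum n))) N.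
    rewrite big_mkord (bigD1 (Ordinal gN))//= /a Kr eqxx big1 ?adde0.
      by rewrite /g gN -EFinM mulrC.
    move=> i /eqP ne; case: eqP => // pE; rewrite ?mule0//.
    by case: ne; apply: val_inj; rewrite /= pE rK.
  rewrite /g ltnNge gN/= csq0 mulr0 big_nat big1// => i /andP[_ iN].
  rewrite /a; case: eqP => pE; last by rewrite mule0.
  by move: gN; rewrite pE rK leqNgt iN.
rewrite nneseries_sum; last by move=> *; rewrite mule_ge0// lee_fin csq_ge0.
apply: lte_sum_pinfty => i _.
rewrite nneseriesZl//; apply: lte_mul_pinfty; rewrite ?lee_fin ?csq_ge0//.
apply: le_lt_trans (wmeasure_fiber_lty (enum i)).
rewrite /wmeasure esum_mkcond esum_enum; last by move=> x; case: ifP; rewrite // lee_fin.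
apply: lee_nneseries => // n _; rewrite /a; case: eqP => pE; last by case: ifP; rewrite // lee_fin.
by rewrite mem_set.
Qed.

End WeightedL2.

(** * Subnormality from a bijective dilation *)

Section BijectiveDilation.
Context d (T : measurableType d) (R : realType) (m : {measure set T -> \bar R}).
Variables (Phi Psi : T -> T) (h : T -> R).
Hypotheses (mPhi : measurable_fun setT Phi) (mPsi : measurable_fun setT Psi).
Hypotheses (PhiK : cancel Phi Psi) (PsiK : cancel Psi Phi).
Hypotheses (mh : measurable_fun setT h) (h0 : forall x, 0 < h x).
Hypothesis (hPhi : forall x, h (Phi x) = h x).
Hypothesis (cov : forall F : T -> \bar R, measurable_fun setT F -> (forall x, (0 <= F x)%E) ->
  (\int[m]_x F (Phi x) = \int[m]_x ((h x)%:E * F x))%E).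
Context (X : choiceType) (enum : nat -> X) (henum : bijective enum)
  (w : X -> R) (hw : forall x, 0 <= w x) (phi : X -> X).
Hypotheses (ha : forall x, w x = 0 <-> wmeasure w (phi @^-1` [set x]) = 0%E)
  (hb : forall x, 0 < w x -> (wmeasure w (phi @^-1` [set x]) < +oo)%E).
Variable G : nat -> set T.
Hypotheses (tG : trivIset setT G) (mG : forall n, measurable (G n)).
Hypothesis mGw : forall n, m (G n) = (w (enum n))%:E.
Hypothesis GPhi : forall n x, G n x -> exists2 k, enum k = phi (enum n) & G k (Phi x).
Hypothesis GPhiC : forall x, ~ (exists n, G n x) -> ~ (exists n, G n (Phi x)).

Definition spread (c : X -> R) : T -> R := glue G (fun n _ => c (enum n)) (fun=> 0).

Lemma measurable_spread c : measurable_fun setT (spread c).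
Proof. by apply: measurable_glue => // n; exact: measurable_cst. Qed.

Lemma spread_Phi c x : spread c (Phi x) = spread (c \o phi) x.
Proof.
rewrite /spread; have [[n Gn]|nG] := pselect (exists n, G n x).
  have [k ek Gk] := GPhi Gn.
  by rewrite (glueE _ _ tG Gn) (glueE _ _ tG Gk) ek.
by rewrite !glueN//; exact: GPhiC.
Qed.

Lemma spread_lin a (b c : X -> R) x :
  spread (fun y => a * b y + c y) x = a * spread b x + spread c x.
Proof.
rewrite /spread; have [[n Gn]|nG] := pselect (exists n, G n x).
  by rewrite !(glueE _ _ tG Gn).
by rewrite !glueN// mulr0 addr0.
Qed.

Lemma sqint_spread c :
  sqint m (spread c) = (\sum_(0 <= n <oo) (w (enum n) * c (enum n) ^+ 2)%:E)%E.
Proof.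
pose D := \bigcup_n G n.
have mD : measurable D by exact: bigcup_measurable.
have ms : measurable_fun setT (fun x => (spread c x ^+ 2)%:E).
  by apply: measurable_sq; exact: measurable_spread.
transitivity (\int[m]_(x in D) (spread c x ^+ 2)%:E)%E.
  rewrite [RHS]integral_mkcond; apply: eq_integral => x _; rewrite patchE.
  case: ifPn => // /negP xD; rewrite /spread glueN ?expr0n//.
  by move=> [n Gn]; apply: xD; rewrite inE; exists n.
rewrite ge0_integral_bigcup//; last 2 first.
- exact: measurable_funTS.
- by move=> x _; rewrite lee_fin sqr_ge0.
apply: eq_eseriesr => n _.
transitivity (\int[m]_(x in G n) (c (enum n) ^+ 2)%:E)%E.
  by apply: eq_integral => x; rewrite inE => Gn; rewrite /spread (glueE _ _ tG Gn).
by rewrite integral_cst// mGw -EFinM mulrC.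
Qed.

Lemma sqint_spreadD f :
  (sqint m (spread (fun x => complex.Re (f x))) +
   sqint m (spread (fun x => complex.Im (f x))) = l2norm2 w f)%E.
Proof.
rewrite !sqint_spread (l2norm2E henum hw) -nneseriesD.
- by apply: eq_eseriesr => n _; rewrite /csq mulrDr.
- by move=> n _ _; rewrite lee_fin mulr_ge0// sqr_ge0.
- by move=> n _ _; rewrite lee_fin mulr_ge0// sqr_ge0.
Qed.

Lemma l2_spread f : inL2 w f -> l2 m (spread (fun x => complex.Re (f x))) /\
  l2 m (spread (fun x => complex.Im (f x))).
Proof.
rewrite /inL2 -sqint_spreadD => H; split; split; try exact: measurable_spread.
  by apply: le_lt_trans H; rewrite leeDl// sqint_ge0.
by apply: le_lt_trans H; rewrite leeDr// sqint_ge0.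
Qed.

Theorem Cphi_subnormal_of_dilation : Cphi_subnormal w phi.
Proof.
split; first exact: (dom_Cphi_dense henum hw ha hb).
pose J (f : X -> R[i]) : L2C m := mkK m (spread (fun x => complex.Re (f x)))
  (spread (fun x => complex.Im (f x))).
exists (L2C m), (@ipK _ _ _ m), J, (compo_dom Phi), (compoK Phi); split.
- exact: ipK_hilbert.
- move=> a f g /l2_spread[lf1 lf2] /l2_spread[lg1 lg2].
  rewrite /J mkK_lin//; congr mkK; apply/funext => x.
    rewrite -!spread_lin; congr (spread _ x); apply/funext => y.
    by case: a (f y) (g y) => [? ?] [? ?] [? ?] /=; ring.
  rewrite -!spread_lin; congr (spread _ x); apply/funext => y.
  by case: a (f y) (g y) => [? ?] [? ?] [? ?] /=; ring.
- move=> f lf; have [l1 l2'] := l2_spread lf; rewrite knorm2E -sqint_spreadD /J.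
  congr (_ + _)%E; apply: aeq_sqint.
  + exact: (re_l2 _).1.
  + exact: measurable_spread.
  + exact: re_mkK.
  + exact: (im_l2 _).1.
  + exact: measurable_spread.
  + exact: im_mkK.
- exact: (compoK_normal mPhi mPsi PhiK PsiK mh h0 hPhi cov).
- move=> f [/l2_spread[lf1 lf2] /l2_spread[lg1 lg2]].
  have E c : compo Phi (spread c) = spread (c \o phi).
    by apply/funext => x; exact: spread_Phi.
  split; first by apply: (compo_dom_mkK mPhi mh cov) => //; rewrite E.
  by rewrite (compoK_mkK mPhi mh cov) ?E.
Qed.

End BijectiveDilation.

(** * The baker map *)

(** Lebesgue measure is 1/s times its image under u |-> al + u / s, because the two agree on the
    intervals ]a, b]. *)
Lemma ge0_integral_affine (R : realType) (s al : R) (H : R -> \bar R) :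
  0 < s -> measurable_fun setT H -> (forall v, (0 <= H v)%E) ->
  (\int[@lebesgue_measure R]_u H (al + u / s)%R = s%:E * \int[@lebesgue_measure R]_v H v)%E.
Proof.
move=> s0 mH H0.
pose g (u : measurableTypeR R) : measurableTypeR R := al + u / s.
have mg : measurable_fun setT g.
  by apply: measurable_funD => //; apply: measurable_funM.
have r0 : 0 <= s^-1 by rewrite invr_ge0 ltW.
pose pf : {measure set (measurableTypeR R) -> \bar R} := pushforward (@lebesgue_measure R) g.
pose mu : {measure set (measurableTypeR R) -> \bar R} := mscale (NngNum r0) (pf mg).
have E A : measurable A -> lebesgue_measure A = mu A.
  apply: lebesgue_measure_unique => _ [[a b] /= ab <-].
  rewrite /mu /mscale/= /pf /pushforward.
  rewrite (_ : g @^-1` `]a, b]%classic = `](s * (a - al)), (s * (b - al))]%classic); last first.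
    apply/seteqP; split => x /=; rewrite !in_itv/= /g => /andP[h1 h2]; apply/andP; split.
    - by rewrite mulrC -ltr_pdivlMr// ltrBlDl.
    - by rewrite mulrC -ler_pdivrMr// lerBrDl.
    - by rewrite -ltrBlDl ltr_pdivlMr// mulrC.
    - by rewrite -lerBrDl ler_pdivrMr// mulrC.
  rewrite !lebesgue_measure_itv/= !lte_fin ltr_pM2l// ltrD2r.
  case: ifP => _; last by rewrite mule0.
  by rewrite -?EFinB -?EFinM; congr EFin => /=; field; rewrite gt_eqF.
transitivity (\int[pf mg]_v H v)%E.
  by rewrite /pf ge0_integral_pushforward//.
have -> : (\int[@lebesgue_measure R]_v H v = \int[mu]_v H v)%E.
  by apply: eq_measure_integral => A mA _; exact: E.
rewrite /mu ge0_integral_mscale// muleA -EFinM/=.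
by rewrite divff ?gt_eqF// mul1e.
Qed.

Section Shear.
Context (R : realType) (la : {sigma_finite_measure set R -> \bar R}).
Notation T := (R * measurableTypeR R)%type.
Definition area : {measure set T -> \bar R} := (la \x @lebesgue_measure R)%E.

(** By Tonelli this is the affine change of variable on each line t = const. *)
Lemma ge0_integral_shear (s al : R -> R) (H : T -> \bar R) :
  measurable_fun setT s -> measurable_fun setT al -> (forall t, 0 < s t) ->
  measurable_fun setT H -> (forall z, (0 <= H z)%E) ->
  (\int[area]_z H (z.1, al z.1 + z.2 / s z.1)%R = \int[area]_z ((s z.1)%:E * H z))%E.
Proof.
move=> ms mal s0 mH H0.
have msi : measurable_fun setT (fun z : T => (s z.1)^-1).
  (* The inverse is written as a power, legitimate since [s] is positive, so that [measurable_powR]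
     applies. *)
  apply: (eq_measurable_fun (fun z : T => powR (s z.1) (-1))).
    by move=> z _; rewrite powR_inv1// ltW.
  apply: (measurableT_comp (measurable_powR _)) => //.
  exact: (measurableT_comp ms measurable_fst).
have ms1 : measurable_fun setT (fun z : T => s z.1) by exact: measurableT_comp.
have mal1 : measurable_fun setT (fun z : T => al z.1) by exact: measurableT_comp.
rewrite /area !fubini_tonelli1//=; last 3 first.
- by apply: emeasurable_funM => //; exact/measurable_EFinP.
- by move=> z; rewrite mule_ge0// lee_fin ltW.
- apply: measurableT_comp => //; apply: measurable_fun_pair => //.
  by apply: measurable_funD => //; apply: measurable_funM.
apply: eq_integral => t _; rewrite /fubini_F/=.
rewrite (ge0_integral_affine (al t) (s0 t) (H := fun v => H (t, v)))//; last first.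
  exact: measurableT_comp.
rewrite ge0_integralZl//.
- exact: measurableT_comp.
- by rewrite lee_fin ltW.
Qed.

End Shear.

(** * Cells, subcells and the piecewise affine bijection *)

Section Baker.
Context (R : realType) (la : {sigma_finite_measure set R -> \bar R}).
Notation T := (R * measurableTypeR R)%type.
Variables (p : nat -> R -> R) (phi : nat -> nat).
Hypothesis mp : forall n, measurable_fun setT (p n).
Hypothesis p_ge0 : forall n t, 0 <= p n t.
Hypothesis p_npos : forall n t, t <= 0 -> p n t = 0.
Hypothesis p_fiber : forall n t, 0 < t ->
  (\sum_(0 <= k <oo) (if phi k == n then p k t else 0)%:E = (t * p n t)%:E)%E.

Definition base n t := \sum_(k < n) p k t.
Definition fiber_sum x n t := \sum_(k < n) (if phi k == x then p k t else 0).
Definition fiber_base n := fiber_sum (phi n) n.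
(* The value 1 for t <= 0, where all cells are empty, makes [to_subcell n] and
   [of_subcell n] inverse bijections of the whole plane. *)
Definition slope (t : R) : R := if 0 < t then t else 1.

(* On each line t = const the cells are stacked intervals of length [p n t].  The
   affine map [to_subcell n] of slope 1/t sends [cell n] onto [subcell n], and by the
   identity [p_fiber] the subcells over the fiber of x partition [cell x]. *)
Definition cell n : set T := [set z | (base n z.1 <= z.2 < base n z.1 + p n z.1)].
Definition subcell n : set T := [set z |
  (fiber_base n z.1 <= slope z.1 * (z.2 - base (phi n) z.1) < fiber_base n z.1 + p n z.1)].
(** Chosen so that the bottom of cell [n] lands at height [fiber_base n / slope] above the bottom of
    cell [phi n]. *)
Definition offset n t := base (phi n) t + (fiber_base n t - base n t) / slope t.
Definition to_subcell n (z : T) : T := (z.1, offset n z.1 + z.2 / slope z.1).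
Definition of_subcell n (z : T) : T :=
  (z.1, base n z.1 + (slope z.1 * (z.2 - base (phi n) z.1) - fiber_base n z.1)).

Lemma slope_gt0 t : 0 < slope t.
Proof. by rewrite /slope; case: ifP. Qed.

Lemma to_subcellK n : cancel (to_subcell n) (of_subcell n).
Proof.
move=> [t u]; rewrite /to_subcell /of_subcell/=; congr pair; rewrite /offset.
by field; rewrite gt_eqF ?slope_gt0.
Qed.

Lemma of_subcellK n : cancel (of_subcell n) (to_subcell n).
Proof.
move=> [t u]; rewrite /to_subcell /of_subcell/=; congr pair; rewrite /offset.
by field; rewrite gt_eqF ?slope_gt0.
Qed.

Lemma mem_to_subcell n z : subcell n (to_subcell n z) <-> cell n z.
Proof.
rewrite /subcell /cell /to_subcell/= /offset.
rewrite (_ : slope z.1 * _ = fiber_base n z.1 + (z.2 - base n z.1)); last first.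
  by field; rewrite gt_eqF ?slope_gt0.
by rewrite lerDl subr_ge0 ltrD2l ltrBlDl.
Qed.

Lemma mem_of_subcell n z : cell n (of_subcell n z) <-> subcell n z.
Proof. by rewrite -mem_to_subcell of_subcellK. Qed.

Lemma base_mono n k t : (n < k)%N -> base n t + p n t <= base k t.
Proof.
move=> nk; rewrite /base -!(big_mkord xpredT (p ^~ t)) (@big_cat_nat _ _ _ n.+1 0 k)//=.
by rewrite big_nat_recr//= lerDl sumr_ge0.
Qed.

Lemma fiber_sum_mono x n k t : (n < k)%N ->
  fiber_sum x n.+1 t <= fiber_sum x k t.
Proof.
pose q k := if phi k == x then p k t else 0.
have q0 j : 0 <= q j by rewrite /q; case: ifP.
move=> nk; rewrite /fiber_sum -(big_mkord xpredT q).
rewrite -[X in _ <= X](big_mkord xpredT q) (@big_cat_nat _ _ _ n.+1 0 k)//=.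
by rewrite lerDl sumr_ge0.
Qed.

Lemma fiber_sum_le x n t : 0 < t -> fiber_sum x n t <= t * p x t.
Proof.
move=> t0; rewrite -lee_fin -p_fiber//.
apply: le_trans (nneseries_lim_ge n _) => /=; last first.
  by move=> i _ _; rewrite lee_fin; case: ifP.
by rewrite /fiber_sum big_mkord sumEFin.
Qed.

(** The partial sums have supremum t p_x(t) but may never exceed or even reach it; this is why the
    cells exclude their upper end. *)
Lemma fiber_sum_sup x t v : 0 < t -> v < t * p x t -> exists n, v < fiber_sum x n t.
Proof.
move=> t0 vp; apply: contrapT => /forallNP H.
move: vp; rewrite -lte_fin -p_fiber// ltNge => /negP; apply.
apply: lime_le.
  by apply: is_cvg_nneseries => n _ _; rewrite lee_fin; case: ifP.
apply: nearW => n; rewrite big_mkord sumEFin lee_fin leNgt; apply/negP; exact: H.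
Qed.

Lemma cell_triv : trivIset setT cell.
Proof.
have H n k z : (n < k)%N -> cell n z -> cell k z -> False.
  move=> nk /andP[_ h1] /andP[h2 _].
  by have := le_trans (base_mono z.1 nk) h2; rewrite leNgt h1.
move=> n k _ _ [z [zn zk]]; case: (ltngtP n k) => // nk.
  by case: (H _ _ _ nk zn zk).
by case: (H _ _ _ nk zk zn).
Qed.

Lemma cell_pos n z : cell n z -> 0 < z.1.
Proof.
move=> /andP[h1 h2]; rewrite ltNge; apply/negP => t0.
by move: h2; rewrite p_npos// addr0 ltNge h1.
Qed.

Lemma subcell_pos n z : subcell n z -> 0 < z.1.
Proof. by move=> /mem_of_subcell /cell_pos. Qed.

Lemma slope_pos t : 0 < t -> slope t = t.
Proof. by rewrite /slope => ->. Qed.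

Lemma fiber_base_recr n t : fiber_sum (phi n) n.+1 t = fiber_base n t + p n t.
Proof. by rewrite /fiber_sum big_ord_recr/= eqxx. Qed.

Lemma fiber_sum_ge0 x n t : 0 <= fiber_sum x n t.
Proof. by apply: sumr_ge0 => k _; case: ifP. Qed.

(** After stretching by t, the top of the subcell is a partial sum over the fiber, hence at most t
    p(t), the stretched length of the target cell. *)
Lemma subcell_sub n z : subcell n z -> cell (phi n) z.
Proof.
move=> sz; have t0 := subcell_pos sz; move: sz; rewrite /subcell/cell/= slope_pos//.
move=> /andP[h1 h2]; apply/andP; split.
  have := le_trans (fiber_sum_ge0 _ _ _) h1.
  by rewrite pmulr_rge0// subr_ge0.
have := lt_le_trans h2 _; rewrite -fiber_base_recr => /(_ _ (fiber_sum_le _ _ t0)).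
by rewrite ltr_pM2l// ltrBlDl.
Qed.

(** Subcells over different points lie in different cells; those over the same point are stacked by
    increasing partial sums. *)
Lemma subcell_triv : trivIset setT subcell.
Proof.
have H n k z : (n < k)%N -> subcell n z -> subcell k z -> False.
  move=> nk zn zk.
  have E : phi n = phi k.
    by apply: (cell_triv I I); exists z; split; exact: subcell_sub.
  move: zn zk => /andP[_ h1] /andP[h2 _].
  have := fiber_sum_mono (phi n) z.1 nk; rewrite fiber_base_recr E.
  move=> /le_trans/(_ h2); rewrite -E leNgt.
  by rewrite h1.
move=> n k _ _ [z [zn zk]]; case: (ltngtP n k) => // nk.
  by case: (H _ _ _ nk zn zk).
by case: (H _ _ _ nk zk zn).
Qed.

(** The stretched height [v] lies below some partial sum over the fiber. At the first such partial
    sum, the last index added must belong to the fiber, since otherwise the sum would not have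
    grown; its subcell contains [z]. *)
Lemma cell_cover x z : cell x z -> exists2 n, phi n = x & subcell n z.
Proof.
move=> cz; have t0 := cell_pos cz; move: cz => /andP[h1 h2].
set v := z.1 * (z.2 - base x z.1).
have v0 : 0 <= v by rewrite mulr_ge0 ?subr_ge0// ltW.
have vp : v < z.1 * p x z.1 by rewrite ltr_pM2l// ltrBlDl.
have ex : exists n, v < fiber_sum x n z.1 by exact: fiber_sum_sup.
(* The minimum is not 0, because the empty sum is 0 and [v] is nonnegative. *)
case: (ex_minnP ex) => -[|n] Hn minn.
  by move: Hn; rewrite /fiber_sum big_ord0 ltNge v0.
have vn : fiber_sum x n z.1 <= v.
  by rewrite leNgt; apply/negP => /minn; rewrite ltnn.
have E : phi n = x.
  apply/eqP/negPn/negP => /negbTE ne; move: Hn.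
  by rewrite /fiber_sum big_ord_recr/= ne addr0 ltNge vn.
exists n => //; rewrite /subcell/= slope_pos// E -/v /fiber_base E vn/=.
by rewrite -[X in _ < X + _]/(fiber_sum x n z.1) -E -/(fiber_base n _) -fiber_base_recr E.
Qed.


Lemma measurable_fiber_sum x n : measurable_fun setT (fiber_sum x n).
Proof.
rewrite /fiber_sum; apply: measurable_sum => k.
by case: (phi k == x); [exact: mp|exact: measurable_cst].
Qed.

Lemma measurable_base n : measurable_fun setT (base n).
Proof. by rewrite /base; apply: measurable_sum => k; exact: mp. Qed.

Lemma measurable_slope : measurable_fun setT slope.
Proof. by apply: measurable_fun_ifT => //; exact: measurable_fun_ltr. Qed.

Lemma measurable_offset n : measurable_fun setT (offset n).
Proof.
apply: measurable_funD; first exact: measurable_base.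
apply: (eq_measurable_fun (fun t => (fiber_base n t - base n t) * powR (slope t) (-1))).
  by move=> t _; rewrite powR_inv1// ltW// slope_gt0.
apply: measurable_funM.
  by apply: measurable_funB; [exact: measurable_fiber_sum|exact: measurable_base].
exact: (measurableT_comp (measurable_powR (-1)) measurable_slope).
Qed.

Let m1 (f : R -> R) : measurable_fun setT f -> measurable_fun setT (fun z : T => f z.1).
Proof. by move=> mf; exact: measurableT_comp. Qed.

Let mitv (f g k : T -> R) : measurable_fun setT f -> measurable_fun setT g ->
  measurable_fun setT k -> measurable [set z | f z <= g z < k z].
Proof.
move=> mf mg mk; rewrite -[X in measurable X]setTI.
suff : measurable_fun setT (fun z => (f z <= g z) && (g z < k z)).
  by move=> /(_ measurableT [set true]); apply.
by apply: measurable_and; [exact: measurable_fun_ler|exact: measurable_fun_ltr].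
Qed.

Lemma measurable_cell n : measurable (cell n).
Proof.
apply: mitv => //; first exact: m1 (measurable_base n).
by apply: measurable_funD; apply: m1 => //; exact: measurable_base.
Qed.

Lemma measurable_subcell n : measurable (subcell n).
Proof.
apply: mitv.
- exact: m1 (measurable_fiber_sum _ n).
- apply: measurable_funM; first exact: m1 measurable_slope.
  by apply: measurable_funB => //; exact: m1 (measurable_base _).
- by apply: measurable_funD; apply: m1 => //; exact: measurable_fiber_sum.
Qed.

Lemma measurable_to_subcell n : measurable_fun setT (to_subcell n).
Proof.
apply: measurable_fun_pair => //; apply: measurable_funD.
  exact: m1 (measurable_offset n).
apply: (eq_measurable_fun (fun z : T => z.2 * powR (slope z.1) (-1))).
  by move=> t _; rewrite powR_inv1// ltW// slope_gt0.
apply: measurable_funM => //.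
apply: (m1 (f := fun t => powR (slope t) (-1))).
exact: (measurableT_comp (measurable_powR (-1)) measurable_slope).
Qed.

Lemma measurable_of_subcell n : measurable_fun setT (of_subcell n).
Proof.
apply: measurable_fun_pair => //; apply: measurable_funD.
  exact: m1 (measurable_base n).
apply: measurable_funB; last exact: m1 (measurable_fiber_sum _ _).
apply: measurable_funM; first exact: m1 measurable_slope.
by apply: measurable_funB => //; exact: m1 (measurable_base _).
Qed.

Lemma area_cell n : area la (cell n) = (\int[la]_t (p n t)%:E)%E.
Proof.
transitivity (\int[la]_t lebesgue_measure (xsection (cell n) t))%E; first by [].
apply: eq_integral => t _.
rewrite (_ : xsection _ _ = `[base n t, base n t + p n t[%classic); last first.
  by apply/seteqP; split => u; [move=> /xsectionP|move=> H; apply/xsectionP; move: H];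
    rewrite /cell/= in_itv.
rewrite lebesgue_measure_itv/= lte_fin ltrDl.
case: ifPn => [_|]; first by rewrite -EFinB addrAC subrr add0r.
by rewrite -leNgt => pn; congr EFin; apply/eqP; rewrite eq_le p_ge0 pn.
Qed.

Definition baker := glue cell to_subcell id.
Definition baker_inv := glue subcell of_subcell id.
Definition jacobian := glue cell (fun _ z => slope z.1) (fun=> 1 : R).

(** Cells and subcells have the same union, so [baker] and [baker_inv] can both be the identity on
    its complement and remain inverse to each other. *)
Lemma subcellP z : (exists n, subcell n z) <-> (exists n, cell n z).
Proof.
split=> -[n zn]; first by exists (phi n); exact: subcell_sub.
by have [k _ zk] := cell_cover zn; exists k.
Qed.

Lemma bakerE n z : cell n z -> baker z = to_subcell n z.
Proof. by move=> zn; rewrite /baker (glueE _ _ cell_triv zn). Qed.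

Lemma baker_id z : ~ (exists n, cell n z) -> baker z = z.
Proof. by move=> zn; rewrite /baker glueN. Qed.

Lemma bakerK : cancel baker baker_inv.
Proof.
move=> z; have [[n zn]|nz] := pselect (exists n, cell n z).
  rewrite (bakerE zn) /baker_inv (glueE _ _ subcell_triv (n := n)) ?to_subcellK//.
  exact/mem_to_subcell.
by rewrite baker_id// /baker_inv glueN// subcellP.
Qed.

Lemma baker_invK : cancel baker_inv baker.
Proof.
move=> z; have [[n zn]|nz] := pselect (exists n, subcell n z).
  rewrite /baker_inv (glueE _ _ subcell_triv zn) (bakerE (n := n)) ?of_subcellK//.
  exact/mem_of_subcell.
by rewrite /baker_inv glueN// baker_id// -subcellP.
Qed.

Lemma baker_cell n z : cell n z -> cell (phi n) (baker z).
Proof. by move=> zn; rewrite (bakerE zn); apply/subcell_sub/mem_to_subcell. Qed.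

Lemma jacobian_gt0 z : 0 < jacobian z.
Proof.
rewrite /jacobian; have [[n zn]|nz] := pselect (exists n, cell n z).
  by rewrite (glueE _ _ cell_triv zn) slope_gt0.
by rewrite glueN.
Qed.

Lemma jacobian_baker z : jacobian (baker z) = jacobian z.
Proof.
rewrite /jacobian; have [[n zn]|nz] := pselect (exists n, cell n z).
  rewrite (glueE _ _ cell_triv zn) (glueE _ _ cell_triv (baker_cell zn)).
  by rewrite (bakerE zn).
by rewrite baker_id.
Qed.

Lemma measurable_baker : measurable_fun setT baker.
Proof.
apply: measurable_glue; [exact: cell_triv|exact: measurable_cell|exact: measurable_to_subcell|].
exact: measurable_id.
Qed.

Lemma measurable_baker_inv : measurable_fun setT baker_inv.
Proof.
apply: measurable_glue; [exact: subcell_triv|exact: measurable_subcell|exact: measurable_of_subcell|].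
exact: measurable_id.
Qed.

Lemma measurable_jacobian : measurable_fun setT jacobian.
Proof.
apply: measurable_glue; [exact: cell_triv|exact: measurable_cell| |exact: measurable_cst].
by move=> n; exact: m1 measurable_slope.
Qed.

Lemma integral_to_subcell n (F : T -> \bar R) : measurable_fun setT F ->
  (forall z, (0 <= F z)%E) ->
  (\int[area la]_(z in cell n) F (to_subcell n z) =
   \int[area la]_(z in subcell n) ((slope z.1)%:E * F z))%E.
Proof.
move=> mF F0; rewrite integral_mkcond [RHS]integral_mkcond.
(* Extending [F] by 0 off the subcell gives integrals over the whole plane, where the shear formula
   holds. *)
have mFs : measurable_fun setT (F \_ (subcell n)).
  apply/(measurable_restrictT _ _).1; first exact: measurable_subcell.
  exact: measurable_funTS.
transitivity (\int[area la]_z (F \_ (subcell n)) (to_subcell n z))%E.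
  apply: eq_integral => z _; rewrite !patchE.
  have [zn|zn] := pselect (cell n z).
    by rewrite !mem_set//; apply/mem_to_subcell.
  by rewrite !memNset// mem_to_subcell.
rewrite (ge0_integral_shear la measurable_slope (measurable_offset n) slope_gt0 mFs).
  apply: eq_integral => z _; rewrite !patchE; case: ifP => // _.
  by rewrite mule0.
by move=> z; rewrite patchE; case: ifP.
Qed.

(** The common union [D] is cut into cells on the left and into subcells on the right, and the terms
    match one by one; off [D] the map is the identity with Jacobian 1. *)
Lemma integral_baker (F : T -> \bar R) : measurable_fun setT F -> (forall z, (0 <= F z)%E) ->
  (\int[area la]_z F (baker z) = \int[area la]_z ((jacobian z)%:E * F z))%E.
Proof.
move=> mF F0; pose D := \bigcup_n cell n.
have mD : measurable D by apply: bigcup_measurable => n _; exact: measurable_cell.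
have DE : D = \bigcup_n subcell n.
  apply/seteqP; split => z [n _ zn].
    by have [k _ zk] := cell_cover zn; exists k.
  by exists (phi n) => //; exact: subcell_sub.
have mFb : measurable_fun setT (fun z => F (baker z)).
  by apply: measurableT_comp => //; exact: measurable_baker.
have mJF : measurable_fun setT (fun z => (jacobian z)%:E * F z)%E.
  by apply: emeasurable_funM => //; apply/measurable_EFinP; exact: measurable_jacobian.
have J0 z : (0 <= (jacobian z)%:E * F z)%E.
  by rewrite mule_ge0// lee_fin ltW// jacobian_gt0.
rewrite -(setUv D) !ge0_integral_setU//; last 6 first.
- exact: measurableC.
- by rewrite setUv.
- by apply/disj_setPLR; rewrite setCK.
- exact: measurableC.
- by rewrite setUv.
- by apply/disj_setPLR; rewrite setCK.
congr (_ + _)%E; last first.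
  apply: eq_integral => z; rewrite inE => nz.
  have nz' : ~ (exists n, cell n z) by move=> [n zn]; apply: nz; exists n.
  by rewrite baker_id// /jacobian glueN// mul1e.
rewrite [in RHS]DE /D !ge0_integral_bigcup//.
- apply: eq_eseriesr => n _.
  transitivity (\int[area la]_(z in cell n) F (to_subcell n z))%E.
    by apply: eq_integral => z; rewrite inE => zn; rewrite (bakerE zn).
  rewrite integral_to_subcell//; apply: eq_integral => z; rewrite inE => zn.
  by rewrite /jacobian (glueE _ _ cell_triv (subcell_sub zn)).
- exact: measurable_subcell.
- exact: measurable_funTS.
- exact: subcell_triv.
- exact: measurable_cell.
- exact: measurable_funTS.
- exact: cell_triv.
Qed.

End Baker.

(** * Consistency conditions and densities *)

Section Consistency.
Context (R : realType) (X : choiceType) (enum : nat -> X) (henum : bijective enum)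
  (w : X -> R) (phi : X -> X) (P : X -> probability R R).
Hypothesis hP : forall x, P x [set t | t < 0] = 0%E.
Notation rn y x := (Radon_Nikodym_SigmaFinite.f (P y) (P x)).

Definition in_fiber x k := (phi (enum k) == x) && (0 < w (enum k)).
Local Notation ratio x k := (w (enum k) / w x).

(** Condition (i) as a series along the enumeration. By (a), positivity of [w x] replaces positivity
    of the fiber. *)
Definition consistent := forall x, 0 < w x -> forall sigma : set R,
  measurable sigma -> sigma `<=` (@Rplus R) ->
  (\int[P x]_(t in sigma) t%:E =
   \sum_(0 <= k <oo) (if in_fiber x k then (ratio x k)%:E * P (enum k) sigma else 0))%E.

Lemma esum_ppos x (c : X -> \bar R) : (forall y, ppos phi w x y -> (0 <= c y)%E) ->
  (\esum_(y in ppos phi w x) c y =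
   \sum_(0 <= k <oo) (if in_fiber x k then c (enum k) else 0))%E.
Proof.
move=> c0; rewrite esum_mkcond (esum_enum henum)//; last first.
  by move=> y; case: ifP => //; rewrite inE => /c0.
apply: eq_eseriesr => k _; congr (if _ then _ else _).
by apply/idP/andP; rewrite inE => -[/eqP ? ?]; split => //; apply/eqP.
Qed.

Lemma ppos_fiber x k : in_fiber x k -> ppos phi w x (enum k).
Proof. by move=> /andP[/eqP ? ?]. Qed.

Lemma fiber_ratio_ge0 x k : 0 < w x -> in_fiber x k -> 0 <= ratio x k.
Proof. by move=> x0 /andP[_ k0]; rewrite divr_ge0 ?ltW. Qed.

Lemma fiber_ratio_gt0 x k : 0 < w x -> in_fiber x k -> 0 < ratio x k.
Proof. by move=> x0 /andP[_ k0]; rewrite divr_gt0. Qed.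

Lemma measurable_Rplus : measurable (@Rplus R : set (measurableTypeR R)).
Proof.
rewrite (_ : @Rplus R = `[0, +oo[%classic) //.
by apply/seteqP; split => t; rewrite /Rplus/= in_itv/= andbT.
Qed.

Lemma measurable_rn y x : P y `<< P x -> measurable_fun setT (rn y x).
Proof. by move=> yx; apply: measurable_int (Radon_Nikodym_SigmaFinite.f_integrable yx). Qed.

(** Integrate the pointwise identity over [sigma] term by term; nonnegativity allows the exchange
    with the series. *)
Lemma consistent_of_density x : 0 < w x ->
  (forall k, in_fiber x k -> P (enum k) `<< P x) ->
  {ae P x, forall t : R, (@Rplus R) t -> t%:E =
    (\sum_(0 <= k <oo) (if in_fiber x k then (ratio x k)%:E * rn (enum k) x t else 0))%E} ->
  forall sigma : set R, measurable sigma -> sigma `<=` (@Rplus R) ->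
  (\int[P x]_(t in sigma) t%:E =
   \sum_(0 <= k <oo) (if in_fiber x k then (ratio x k)%:E * P (enum k) sigma else 0))%E.
Proof.
move=> x0 dom dens sigma ms sp.
pose g k t := (if in_fiber x k then (ratio x k)%:E * rn (enum k) x t else 0)%E.
have g0 k t : (0 <= g k t)%E.
  rewrite /g; case: ifP => // fk; rewrite mule_ge0 ?lee_fin ?fiber_ratio_ge0//.
  by apply: Radon_Nikodym_SigmaFinite.f_ge0; exact: dom.
have mg k : measurable_fun setT (g k).
  rewrite /g; case: (boolP (in_fiber x k)) => fk; last exact: measurable_cst.
  by apply: emeasurable_funM => //; exact: measurable_rn (dom _ fk).
transitivity (\int[P x]_(t in sigma) \sum_(0 <= k <oo) g k t)%E.
  apply: ae_eq_integral => //.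
  - apply: measurable_funTS; apply: ge0_emeasurable_sum => //.
  - by apply: filterS dens => t H st; exact: H (sp _ st).
rewrite integral_nneseries//; last by move=> k; exact: measurable_funTS.
apply: eq_eseriesr => k _; rewrite /g; case: ifPn => fk; last by rewrite integral0.
rewrite ge0_integralZl//.
- by rewrite -(Radon_Nikodym_SigmaFinite.f_integral (dom _ fk)).
- exact: measurable_funTS (measurable_rn (dom _ fk)).
- by move=> t _; apply: Radon_Nikodym_SigmaFinite.f_ge0; exact: dom.
- by rewrite lee_fin fiber_ratio_ge0.
Qed.

(** Conditions (iii) and (iv) speak of [Radon_Nikodym], the proof of a version that is nonnegative
    everywhere. Countably many almost everywhere equalities are collected into one. *)
Let rn_ae x : (forall k, in_fiber x k -> P (enum k) `<< P x) ->
  {ae P x, forall t, forall k, in_fiber x k ->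
    Radon_Nikodym (charge_of_finite_measure (P (enum k))) (P x) t = rn (enum k) x t}.
Proof.
move=> dom; apply: ae_foralln => k.
case: (boolP (in_fiber x k)) => fk; last by apply: aeW.
have := ae_eq_Radon_Nikodym_SigmaFinite (dom _ fk) measurableT.
by apply: filterS => t /(_ I) ->.
Qed.

(** Multiply by t, which is nonzero almost everywhere because {0} is null for [P x]. *)
Lemma density_of_normalized x : 0 < w x -> P x [set 0] = 0%E ->
  (forall k, in_fiber x k -> P (enum k) `<< P x) ->
  {ae P x, forall t : R, (@Rplus R) t -> 1%E =
    (\sum_(0 <= k <oo) (if in_fiber x k then (ratio x k)%:E * einv t * rn (enum k) x t else 0))%E} ->
  {ae P x, forall t : R, (@Rplus R) t -> t%:E =
    (\sum_(0 <= k <oo) (if in_fiber x k then (ratio x k)%:E * rn (enum k) x t else 0))%E}.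
Proof.
move=> x0 P0 dom.
have n0 : {ae P x, forall t : R, t != 0}.
  exists [set 0]; split => //.
  by move=> t /= /negP; rewrite negbK => /eqP.
apply: filterS2 n0 => t t0 H tp; have {H} := H tp.
rewrite /einv (negbTE t0) => H.
rewrite -[LHS]mule1 H -nneseriesZl; last first.
  move=> k _; case: ifP => // fk; rewrite !mule_ge0 ?lee_fin ?fiber_ratio_ge0 ?invr_ge0//.
  by apply: Radon_Nikodym_SigmaFinite.f_ge0; exact: dom.
apply: eq_eseriesr => k _; case: ifP => fk; last by rewrite mule0.
rewrite muleA -!EFinM mulrC -mulrA mulVf// mulr1//.
Qed.

(* Agrees with [einv] on the half-line, but is nonnegative and measurable on R. *)
Let einv_pow (t : R) : \bar R := if t == 0 then +oo%E else (powR t (-1))%:E.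

Let einv_powE t : (@Rplus R) t -> einv t = einv_pow t.
Proof. by move=> t0; rewrite /einv /einv_pow; case: ifP => // _; rewrite powR_inv1. Qed.

Let einv_pow_gt0 t : (@Rplus R) t -> (0 < einv_pow t)%E.
Proof.
move=> t0; rewrite /einv_pow; case: ifPn => // tn; rewrite lte_fin powR_gt0//.
by rewrite lt_neqAle eq_sym tn.
Qed.

Let einv_pow_ge0 t : (0 <= einv_pow t)%E.
Proof. by rewrite /einv_pow; case: ifP => // _; rewrite lee_fin powR_ge0. Qed.

Let measurable_einv_pow : measurable_fun setT einv_pow.
Proof.
apply: measurable_fun_ifT.
- exact: measurable_fun_eqr.
- exact: measurable_cst.
- by apply/measurable_EFinP; exact: measurable_powR.
Qed.

(** If [P x] vanishes on A, so does each integral of 1/t over the part of A in R_+; as 1/t is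
    positive there, [P y] vanishes on A. With densities available, (ii) says that 1 and the series
    have equal integrals over every measurable subset of R_+, hence agree almost everywhere. *)
Lemma normalized_of_ii x : 0 < w x -> cond_ii w phi P ->
  (0 < wmeasure w (phi @^-1` [set x]))%E ->
  [/\ P x [set 0] = 0%E, (forall k, in_fiber x k -> P (enum k) `<< P x) &
  {ae P x, forall t : R, (@Rplus R) t -> 1%E =
    (\sum_(0 <= k <oo) (if in_fiber x k then (ratio x k)%:E * einv t * rn (enum k) x t else 0))%E}].
Proof.
move=> x0 cii wx; have [P0 PE] := cii x wx.
have {}PE sigma : measurable sigma -> sigma `<=` (@Rplus R) ->
    (P x sigma = \sum_(0 <= k <oo) (if in_fiber x k then
       (ratio x k)%:E * \int[P (enum k)]_(t in sigma) einv_pow t else 0))%E.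
  move=> ms sp; rewrite PE// esum_ppos; last first.
    move=> y [_ wy]; rewrite mule_ge0//; first by rewrite lee_fin divr_ge0 ?ltW.
    by apply: integral_ge0 => t st; rewrite einv_powE//; exact: sp.
  apply: eq_eseriesr => k _; case: ifP => // _; congr (_ * _)%E.
  by apply: eq_integral => t; rewrite inE => /sp; exact: einv_powE.
have term0 sigma k : in_fiber x k ->
   (0 <= (ratio x k)%:E * \int[P (enum k)]_(t in sigma) einv_pow t)%E.
  move=> fk; rewrite mule_ge0//; first by rewrite lee_fin fiber_ratio_ge0.
  exact: integral_ge0.
have dom k : in_fiber x k -> P (enum k) `<< P x.
  move=> fk; apply/null_content_dominatesP => A mA PA.
  have mAp : measurable (A `&` @Rplus R) by apply: measurableI => //; exact: measurable_Rplus.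
  have PAp : P x (A `&` @Rplus R) = 0%E.
    apply/eqP; rewrite eq_le measure_ge0 andbT -PA le_measure ?inE//.
  have : P (enum k) (A `&` @Rplus R) = 0%E.
    have I0 : (\int[P (enum k)]_(t in A `&` @Rplus R) einv_pow t = 0)%E.
      apply/eqP; rewrite eq_le integral_ge0// andbT.
      have := PE _ mAp (@subIsetr _ _ _); rewrite PAp => S0.
      have : ((ratio x k)%:E * \int[P (enum k)]_(t in A `&` @Rplus R) einv_pow t <= 0)%E.
        rewrite S0; apply: le_trans (nneseries_lim_ge k.+1 _) => /=; last first.
          by move=> i _ _; case: ifP => // fi; exact: term0.
        rewrite big_nat_recr//= fk leeDr// sume_ge0// => i _.
        by case: ifP => // fi; exact: term0.
      by rewrite pmule_rle0// lte_fin fiber_ratio_gt0.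
    have : (\int[P (enum k)]_(t in A `&` @Rplus R) `|einv_pow t| = 0)%E.
      by under eq_integral => t _ do rewrite gee0_abs//.
    move/(ae_eq_integral_abs _ mAp (measurable_funTS measurable_einv_pow)) => H.
    apply/negligibleP => //; case: H => N [mN N0 sN]; exists N; split => //.
    apply: subset_trans sN => t At /= /(_ At) E0.
    by have := einv_pow_gt0 At.2; rewrite E0 ltxx.
  move=> PkA; apply/eqP; rewrite eq_le measure_ge0 andbT.
  have mneg : measurable [set t : R | t < 0].
    rewrite (_ : [set t | t < 0] = ~` @Rplus R); first exact: measurableC measurable_Rplus.
    by apply/seteqP; split => t /=; rewrite /Rplus/= ltNge => /negP.
  apply: (@le_trans _ _ (P (enum k) ((A `&` @Rplus R) `|` [set t : R | t < 0]))).
    apply: le_measure; rewrite ?inE//; first exact: measurableU.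
    by move=> t At; case: (ltP t 0) => tt; [right|left].
  apply: le_trans (measureU2 _ mAp mneg) _.
  by rewrite [X in (X + _)%E]PkA [X in (_ + X)%E](hP (enum k)) adde0.
split => //.
(* Although 1/t is infinite at 0, its integral over {0} vanishes, since [P y] has no mass there. *)
- rewrite PE; last 2 first.
  + exact: measurable_set1.
  + by move=> t /= ->; rewrite /Rplus/=.
  apply: eseries0 => k _ _; case: ifP => // fk.
  rewrite null_set_integral ?mule0//.
  + exact: measurable_funTS.
  + by apply: P0; exact: ppos_fiber.
- pose g k t := (if in_fiber x k then (ratio x k)%:E * einv_pow t * rn (enum k) x t else 0)%E.
  have g0 k t : (0 <= g k t)%E.
    rewrite /g; case: ifP => // fk; rewrite !mule_ge0 ?lee_fin ?fiber_ratio_ge0//.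
    by apply: Radon_Nikodym_SigmaFinite.f_ge0; exact: dom.
  have mg k : measurable_fun setT (g k).
    rewrite /g; case: (boolP (in_fiber x k)) => fk; last exact: measurable_cst.
    apply: emeasurable_funM; last exact: measurable_rn (dom _ fk).
    by apply: emeasurable_funM.
  have : ae_eq (P x) (@Rplus R) (cst 1%E) (fun t => \sum_(0 <= k <oo) g k t)%E.
    apply: integral_ae_eq.
    + exact: measurable_Rplus.
    + by apply: (integrableS measurableT) => //;
      [exact: measurable_Rplus|exact: finite_measure_integrable_cst].
    + by apply: measurable_funTS; exact: ge0_emeasurable_sum.
    + move=> E sE mE; rewrite integral_cst// mul1e [LHS]PE// integral_nneseries//; last first.
        by move=> k; exact: measurable_funTS.
      apply: eq_eseriesr => k _; rewrite /g; case: ifPn => fk; last by rewrite integral0.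
      rewrite -(Radon_Nikodym_SigmaFinite.change_of_variables (dom _ fk))//; last first.
        exact: measurable_funTS.
      rewrite -ge0_integralZl//.
      * by apply: eq_integral => t _; rewrite muleA.
      * apply: measurable_funTS; apply: emeasurable_funM => //.
        exact: measurable_rn (dom _ fk).
      * move=> t _; apply: mule_ge0 => //.
        by apply: Radon_Nikodym_SigmaFinite.f_ge0; exact: dom.
      * by rewrite lee_fin fiber_ratio_ge0.
  apply: filterS => t H tp; rewrite [LHS](H tp).
  by apply: eq_eseriesr => k _; rewrite /g; case: ifP => // _; rewrite einv_powE.
Qed.

Lemma consistent_of_cond (hw : forall x, 0 <= w x)
    (ha : forall x, w x = 0 <-> wmeasure w (phi @^-1` [set x]) = 0%E) :
  cond_i w phi P \/ cond_ii w phi P \/ cond_iii w phi P \/ cond_iv w phi P -> consistent.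
Proof.
move=> hc x x0.
have wx : (0 < wmeasure w (phi @^-1` [set x]))%E.
  rewrite lt0e; apply/andP; split; last by apply: esum_ge0 => y _; rewrite lee_fin.
  by apply/eqP => /ha w0; rewrite w0 ltxx in x0.
case: hc => [ci|[cii|[ciii|civ]]].
- move=> sigma ms sp; rewrite ci// esum_ppos// => y [_ wy].
  by rewrite mule_ge0// lee_fin divr_ge0 ?ltW.
- have [P0 dom H] := normalized_of_ii x0 cii wx.
  by apply: consistent_of_density => //; exact: density_of_normalized.
- have [dom' H] := ciii x wx.
  have dom k : in_fiber x k -> P (enum k) `<< P x by move=> /ppos_fiber /dom'.
  apply: consistent_of_density => //.
  apply: filterS2 H (rn_ae dom) => t H rnE tp; rewrite {1}H// esum_ppos.
    by apply: eq_eseriesr => k _; case: ifP => // fk; rewrite rnE.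
  have [r rK Kr] := henum.
  move=> y py; rewrite -(Kr y) rnE; last first.
    by case: py => p1 p2; rewrite /in_fiber Kr p1 eqxx.
  rewrite mule_ge0//; first by rewrite lee_fin Kr divr_ge0 ?ltW//; case: py.
  by apply: Radon_Nikodym_SigmaFinite.f_ge0; rewrite Kr; exact: dom'.
- have [P0 [dom' H]] := civ x wx.
  have dom k : in_fiber x k -> P (enum k) `<< P x by move=> /ppos_fiber /dom'.
  apply: consistent_of_density => //; apply: density_of_normalized => //.
  apply: filterS2 H (rn_ae dom) => t H rnE tp; rewrite {1}H// esum_ppos.
    by apply: eq_eseriesr => k _; case: ifP => // fk; rewrite rnE.
  have [r rK Kr] := henum.
  move=> y py; rewrite -(Kr y) rnE; last first.
    by case: py => p1 p2; rewrite /in_fiber Kr p1 eqxx.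
  rewrite !mule_ge0//; first by rewrite lee_fin Kr divr_ge0 ?ltW//; case: py.
    by rewrite einv_powE.
  by apply: Radon_Nikodym_SigmaFinite.f_ge0; rewrite Kr; exact: dom'.
Qed.

End Consistency.

(** * A finite measure dominating all the laws *)

Section ReferenceMeasure.
Context (R : realType) (X : choiceType) (enum : nat -> X) (P : X -> probability R R).
Local Open Scope ereal_scope.

Let half_ge0 k : (0 <= (1 : R) / (2 ^ (k + 1))%:R)%R.
Proof. by rewrite divr_ge0. Qed.

(** The weights 2^-(k+1) are positive, so that the sum dominates every law, and summable, so that it
    is finite. *)
Definition weighted_law k : {measure set R -> \bar R} :=
  mscale (NngNum (half_ge0 k)) (P (enum k)).

Definition mixture : set R -> \bar R := mseries weighted_law 0.

HB.instance Definition _ := Measure.on mixture.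

Let mixture_finite : fin_num_fun mixture.
Proof.
apply: lty_fin_num_fun; rewrite /mixture /mseries.
apply: (@le_lt_trans _ _ (\sum_(0 <= k <oo) (1 / (2 ^ (k + 1))%:R)%:E)).
  apply: lee_nneseries => k _; first by move=> _; exact: measure_ge0.
  by rewrite /weighted_law/= /mscale/= [X in _ * X]probability_setT mule1.
have /cvg_lim -> // := @cvg_geometric_eseries_half R 1 0.
exact: ltry.
Qed.

HB.instance Definition _ := Measure_isFinite.Build _ _ _ mixture mixture_finite.

Definition mixture_fin : {finite_measure set R -> \bar R} := mixture.

Lemma mixture_dominates k : P (enum k) `<< mixture.
Proof.
apply/null_content_dominatesP => A mA A0.
have : (1 / (2 ^ (k + 1))%:R)%:E * P (enum k) A <= 0.
  rewrite -A0 /mixture /mseries; apply: le_trans (nneseries_lim_ge k.+1 _) => /=; last first.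
    by move=> i _ _; exact: measure_ge0.
  by rewrite big_nat_recr//= leeDr// sume_ge0.
rewrite pmule_rle0 ?lte_fin ?divr_gt0// ?ltr0n ?expn_gt0// => H.
by apply/eqP; rewrite eq_le H measure_ge0.
Qed.

End ReferenceMeasure.

(** * Densities satisfying the fiber identity at every t > 0 *)

Section Densities.
Context (R : realType) (X : choiceType) (enum : nat -> X) (henum : bijective enum)
  (w : X -> R) (hw : forall x, 0 <= w x) (phi : X -> X).
Hypotheses (ha : forall x, w x = 0 <-> wmeasure w (phi @^-1` [set x]) = 0%E)
  (hb : forall x, 0 < w x -> (wmeasure w (phi @^-1` [set x]) < +oo)%E).
Variable P : X -> probability R R.
Hypothesis hP : forall x, P x [set t | t < 0] = 0%E.
Hypothesis hC : consistent enum w phi P.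

Let la := mixture_fin enum P.
Notation rn k := (Radon_Nikodym_SigmaFinite.f (P (enum k)) la).
Let dom k : P (enum k) `<< la. Proof. exact: mixture_dominates. Qed.

Definition density k t : R := w (enum k) * fine (rn k t).

Lemma density_ge0 k t : 0 <= density k t.
Proof.
rewrite /density mulr_ge0// fine_ge0//.
exact: Radon_Nikodym_SigmaFinite.f_ge0 (dom k) t.
Qed.

Lemma densityE k t : (density k t)%:E = ((w (enum k))%:E * rn k t)%E.
Proof.
by rewrite /density EFinM fineK//; exact: Radon_Nikodym_SigmaFinite.f_fin_num (dom k) t.
Qed.

Lemma measurable_density k : measurable_fun setT (density k).
Proof.
apply: measurable_funM => //; apply: measurableT_comp => //.
exact: measurable_int (Radon_Nikodym_SigmaFinite.f_integrable (dom k)).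
Qed.

Lemma integral_density k (A : set R) : measurable A ->
  (\int[la]_(t in A) (density k t)%:E = (w (enum k))%:E * P (enum k) A)%E.
Proof.
move=> mA; under eq_integral => t _ do rewrite densityE.
rewrite ge0_integralZl//.
- by rewrite -(Radon_Nikodym_SigmaFinite.f_integral (dom k)).
- apply: measurable_funTS.
  exact: measurable_int (Radon_Nikodym_SigmaFinite.f_integrable (dom k)).
- by move=> t _; exact: Radon_Nikodym_SigmaFinite.f_ge0 (dom k) t.
- by rewrite lee_fin.
Qed.

(** The fiber over [phi y] contains [y], so its measure is positive and (a) applies. *)
Lemma fiber_pos y : 0 < w y -> 0 < w (phi y).
Proof.
move=> wy; rewrite lt_neqAle hw andbT; apply/eqP => /esym /ha H.
have : ((w y)%:E <= wmeasure w (phi @^-1` [set phi y]))%E.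
  apply: esum_ge; exists [set y]; last by rewrite fsbig_set1.
  by split => // z ->.
by rewrite H lee_fin leNgt wy.
Qed.

(** Take sigma = {0} in the consistency identity at [phi y]: the left side is 0, and it bounds the
    term of [y]. *)
Lemma prob_at0 y : 0 < w y -> P y [set 0] = 0%E.
Proof.
move=> wy; have [r rK Kr] := henum.
have s0 : [set (0 : R)] `<=` @Rplus R by move=> t ->; rewrite /Rplus/=.
have m0 : measurable [set (0 : R)] by exact: measurable_set1.
have term0 k : (0 <= if in_fiber enum w phi (phi y) k then
    (w (enum k) / w (phi y))%:E * P (enum k) [set 0%R] else 0)%E.
  by case: ifP => // fk; rewrite mule_ge0// lee_fin divr_ge0.
have := hC (fiber_pos wy) m0 s0.
rewrite (_ : (\int[_]_(_ in _) _ = 0)%E); last first.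
  rewrite (eq_integral (cst 0%E)) ?integral0// => t; rewrite inE => ->//.
move=> S0; have : ((w y / w (phi y))%:E * P y [set 0%R] <= 0)%E.
  rewrite S0; apply: le_trans (nneseries_lim_ge (r y).+1 _) => /=; last by move=> i _ _.
  rewrite big_nat_recr//= /in_fiber Kr eqxx wy/=.
  by rewrite leeDr// sume_ge0// => i _; exact: term0.
rewrite pmule_rle0 ?lte_fin ?divr_gt0 ?fiber_pos// => H.
by apply/eqP; rewrite eq_le H measure_ge0.
Qed.

Lemma prob_pos y : 0 < w y -> P y `]0, +oo[ = 1%E.
Proof.
move=> wy.
have mneg : measurable [set t : R | t < 0].
  by rewrite (_ : [set t | t < 0] = `]-oo, 0[%classic) //; apply/seteqP; split => t /=; rewrite in_itv.
have H : P y (~` `]0, +oo[) = 0%E.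
  apply/eqP; rewrite eq_le measure_ge0 andbT.
  apply: (@le_trans _ _ (P y ([set t : R | t < 0] `|` [set 0]))).
    apply: le_measure; rewrite ?inE//.
    - exact: measurableC.
    - exact: measurableU.
    - move=> t /=; rewrite in_itv/= andbT => /negP; rewrite -leNgt le_eqVlt.
      by move=> /orP[/eqP ->|]; [right|left].
  apply: le_trans (measureU2 _ _ _) _ => //.
  by rewrite [X in (X + _)%E](hP y) [X in (_ + X)%E](prob_at0 wy) adde0.
rewrite -(setCK `]0, +oo[%classic) probability_setC ?H ?sube0//.
exact: measurableC.
Qed.

Let pos : set R := `]0, +oo[%classic.

Definition in_fib (n k : nat) := phi (enum k) == enum n.

Lemma w_fiber0 n k : w (enum n) = 0 -> in_fib n k -> w (enum k) = 0.
Proof.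
move=> n0 /eqP kn; apply: contrapT => /eqP k0.
have : 0 < w (enum k) by rewrite lt_neqAle eq_sym k0 hw.
by move=> /fiber_pos; rewrite kn n0 ltxx.
Qed.

Let fib_sum n (E : set R) : 0 < w (enum n) ->
  (\sum_(0 <= k <oo) (if in_fib n k then (w (enum k))%:E * P (enum k) E else 0) =
   (w (enum n))%:E * \sum_(0 <= k <oo) (if in_fiber enum w phi (enum n) k then
      (w (enum k) / w (enum n))%:E * P (enum k) E else 0))%E.
Proof.
move=> n0; rewrite -nneseriesZl; last first.
  by move=> k _; case: ifP => // fk; rewrite mule_ge0// lee_fin divr_ge0.
apply: eq_eseriesr => k _; rewrite /in_fiber -/(in_fib n k).
case: (in_fib n k) => /=; last by rewrite mule0.
case: ifPn => [k0|]; first by rewrite muleA -EFinM mulrCA divff ?mulr1// gt_eqF.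
rewrite -leNgt => k0; rewrite (_ : w (enum k) = 0) ?mul0e ?mule0//.
by apply/eqP; rewrite eq_le k0 hw.
Qed.

(** Both sides have the same integral over every measurable set of positive numbers, by consistency
    at [enum n], and the common integral is finite. *)
Lemma density_fiber n : {ae la, forall t, 0 < t -> (t * density n t)%:E =
  (\sum_(0 <= k <oo) (if in_fib n k then density k t else 0)%:E)%E}.
Proof.
have [n0|n0] := eqVneq (w (enum n)) 0.
  apply: aeW => t _; rewrite /density n0 mul0r mulr0 eseries0// => k _ _.
  by case: ifP => // fk; rewrite (w_fiber0 n0 fk) mul0r.
have {}n0 : 0 < w (enum n) by rewrite lt_neqAle eq_sym n0 hw.
have mpos : measurable pos by exact: measurable_itv.
pose f t : \bar R := (t * density n t)%:E.
pose g k t : \bar R := (if in_fib n k then density k t else 0)%:E.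
have g0 k t : (0 <= g k t)%E by rewrite lee_fin; case: ifP => // _; exact: density_ge0.
have mg k : measurable_fun setT (g k).
  by apply/measurable_EFinP; case: (in_fib n k) => //; exact: measurable_density.
have mf : measurable_fun setT f.
  by apply/measurable_EFinP; apply: measurable_funM => //; exact: measurable_density.
have intE E : measurable E -> E `<=` pos ->
    (\int[la]_(t in E) f t = \int[la]_(t in E) \sum_(0 <= k <oo) g k t)%E.
  move=> mE Ep; have Epos t : E t -> 0 < t by move=> /Ep; rewrite /pos/= in_itv/= andbT.
  have -> : (\int[la]_(t in E) f t = (w (enum n))%:E * \int[P (enum n)]_(t in E) t%:E)%E.
    (* The absolute value agrees with t on [E] and is nonnegative everywhere, as the change of
       measure requires. *)
    rewrite [X in (_ * X)%E](eq_integral (fun t : R => `|t|%:E)) => [|t]; last first.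
      by rewrite inE => /Epos t0; rewrite gtr0_norm.
    rewrite -(Radon_Nikodym_SigmaFinite.change_of_variables (dom n))//; last first.
      by apply/measurable_EFinP; apply: measurable_funTS; exact: normr_measurable.
    rewrite -ge0_integralZl//.
    - apply: eq_integral => t; rewrite inE => /Epos t0.
      by rewrite /f EFinM densityE muleCA gtr0_norm.
    - apply: measurable_funTS; apply: emeasurable_funM.
        by apply/measurable_EFinP; exact: normr_measurable.
      exact: measurable_int (Radon_Nikodym_SigmaFinite.f_integrable (dom n)).
    - move=> t _; rewrite mule_ge0 ?lee_fin//.
      exact: Radon_Nikodym_SigmaFinite.f_ge0 (dom n) t.
    - by rewrite lee_fin.
  rewrite (hC n0 mE); last by move=> t /Epos /ltW.
  rewrite -fib_sum// integral_nneseries//; last by move=> k; exact: measurable_funTS.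
  apply: eq_eseriesr => k _; rewrite /g; case: ifP => _; last by rewrite integral0.
  by rewrite integral_density.
have fI : la.-integrable pos f.
  apply/integrableP; split; first exact: measurable_funTS.
  rewrite (eq_integral f) => [|t]; last first.
    move=> /set_mem tp; have t0 : 0 < t by move: tp; rewrite /pos/= in_itv/= andbT.
    by rewrite gee0_abs// lee_fin mulr_ge0 ?density_ge0// ltW.
  rewrite intE// integral_nneseries//; last by move=> k; exact: measurable_funTS.
  (* Each law has mass at most 1, so the integral is at most the measure of the fiber, finite by
     (b). *)
  apply: le_lt_trans (hb n0).
  rewrite /wmeasure esum_mkcond (esum_enum henum); last first.
    by move=> x; case: ifP => // _; rewrite lee_fin.
  apply: lee_nneseries => k; first by move=> *; apply: integral_ge0 => t _.
  move=> _; rewrite /g (_ : (enum k \in _) = in_fib n k); last first.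
    by apply/idP/idP; rewrite inE => /eqP.
  case: ifPn => fk; last by rewrite integral0_eq.
  rewrite integral_density// -[leRHS]mule1 lee_wpmul2l ?lee_fin//.
  exact: probability_le1.
have mS : measurable_fun pos (fun t => \sum_(0 <= k <oo) g k t)%E.
  by apply: measurable_funTS; exact: ge0_emeasurable_sum.
have := integral_ae_eq mpos fI mS (fun E Ep mE => intE E mE Ep).
by apply: filterS => t H t0; apply: H; rewrite /pos/= in_itv/= andbT.
Qed.

(** One null set [N] serves all [n]. Multiplying every density by the indicator of the positive
    numbers outside [N] makes the identity hold at all t > 0 without changing the integrals. *)
Lemma corrected_density : exists p : nat -> R -> R,
  [/\ forall n, measurable_fun setT (p n),
      forall n t, 0 <= p n t,
      forall n t, t <= 0 -> p n t = 0,
      forall n t, 0 < t -> (\sum_(0 <= k <oo) (if in_fib n k then p k t else 0)%:E =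
        (t * p n t)%:E)%E &
      forall n, (\int[la]_t (p n t)%:E = (w (enum n))%:E)%E].
Proof.
have mpos : measurable pos by exact: measurable_itv.
have [N [mN N0 sN]] := ae_foralln density_fiber.
pose S := pos `\` N.
have mS : measurable S by exact: measurableD.
have in01 t : (\1_S t : R) = 0 \/ (\1_S t : R) = 1 by rewrite indicE; case: (_ \in _); [right|left].
exists (fun n t => \1_S t * density n t); split.
- move=> n; apply: measurable_funM; [exact: measurable_indic|exact: measurable_density].
- by move=> n t; rewrite mulr_ge0 ?density_ge0.
- move=> n t t0; rewrite indicE memNset ?mul0r// => -[]; rewrite /pos/= in_itv/= andbT.
  by rewrite ltNge t0.
- move=> n t t0; case: (in01 t) => E; rewrite E.
    by rewrite mul0r mulr0 eseries0// => k _ _; rewrite mul0r if_same.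
  have St : S t.
    move: E; rewrite indicE; case: (asboolP (S t)) => // nS; rewrite memNset//=.
    by move=> /eqP; rewrite eq_sym oner_eq0.
  rewrite mul1r; have /(_ n t0) -> : forall n, 0 < t -> (t * density n t)%:E =
      (\sum_(0 <= k <oo) (if in_fib n k then density k t else 0)%:E)%E.
    by apply: contrapT => H; apply: St.2; apply: sN.
  by apply: eq_eseriesr => k _; rewrite mul1r.
- move=> n; transitivity (\int[la]_(t in S) (density n t)%:E)%E.
    rewrite [RHS]integral_mkcond; apply: eq_integral => t _; rewrite patchE indicE.
    by case: ifP => _; rewrite ?mul1r ?mul0r.
  rewrite integral_density//.
  have [->|w0] := eqVneq (w (enum n)) 0; first by rewrite mul0e.
  have {}w0 : 0 < w (enum n) by rewrite lt_neqAle eq_sym w0 hw.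
  rewrite (_ : P (enum n) S = 1%E) ?mule1//.
  (* The law lives on the positive half-line and, being dominated, gives [N] mass 0; so [S] carries
     all of it. *)
  apply/eqP; rewrite eq_le probability_le1//= -(prob_pos w0).
  have PN : P (enum n) N = 0%E.
    by have /null_content_dominatesP := dom n; apply.
  apply: (@le_trans _ _ (P (enum n) (S `|` N))).
    apply: le_measure; rewrite ?inE//; first exact: measurableU.
    by move=> t pt; have [Nt|nN] := pselect (N t); [right|left].
  apply: le_trans (measureU2 _ _ _) _ => //.
  by rewrite [X in (_ + X)%E]PN adde0.
Qed.

Lemma consistent_subnormal : Cphi_subnormal w phi.
Proof.
have [r rK Kr] := henum.
have [p [mp p0 pn pf pw]] := corrected_density.
(* [phi] read on the indices of the enumeration, since the cells are stacked in that order. *)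
pose phi' k := r (phi (enum k)).
have phi'E n k : (phi' k == n) = in_fib n k.
  by apply/eqP/eqP => [<-|/= E]; rewrite /phi' ?Kr// E rK.
have pf' n t : 0 < t ->
    (\sum_(0 <= k <oo) (if phi' k == n then p k t else 0)%:E = (t * p n t)%:E)%E.
  by move=> t0; rewrite -pf//; apply: eq_eseriesr => k _; rewrite phi'E.
pose m := area la.
apply: (@Cphi_subnormal_of_dilation _ _ R m _ _ _
  (measurable_baker phi' mp p0) (measurable_baker_inv mp p0 pn pf')
  (bakerK p0 pn pf') (baker_invK p0 pn pf') (measurable_jacobian mp p0)
  (jacobian_gt0 p0) (jacobian_baker p0 pn pf') (integral_baker la mp p0 pn pf')
  X enum henum w hw phi ha hb (cell p) (cell_triv p0) (measurable_cell mp)).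
- by move=> n; rewrite -pw; exact: area_cell.
- move=> n z zn; exists (phi' n); first by rewrite /phi' Kr.
  exact: baker_cell.
- by move=> z nz; rewrite baker_id.
Qed.

End Densities.

Theorem theorem35 (R : realType) (X : choiceType) (enum : nat -> X) (henum : bijective enum)
  (w : X -> R) (hw : forall x, 0 <= w x) (phi : X -> X)
  (ha : forall x, w x = 0 <-> wmeasure w (phi @^-1` [set x]) = 0%E)
  (hb : forall x, 0 < w x -> (wmeasure w (phi @^-1` [set x]) < +oo)%E)
  (P : X -> probability R R)
  (hP : forall x, P x [set t | t < 0] = 0%E)
  (hcond : cond_i w phi P \/ cond_ii w phi P \/ cond_iii w phi P \/ cond_iv w phi P) :
  Cphi_subnormal w phi.
Proof.
have hC : consistent enum w phi P by exact: consistent_of_cond.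
exact: (consistent_subnormal henum hw ha hb hP hC).
Qed.
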